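(* For all $r_0, r_d, d \in \mathbb{Z}_{>0}$ and all integers $s \geq r_0(d r_d + 1) + r_d + 1$, letting $\mathbf{r}$ denote the $(d+1)$-tuple $\mathbf{r} = (r_0, 0, 0, \dotsc, 0, r_d)$, the following holds for all integers $a$ sufficiently large: with $T = T^a_{\mathbf{r}}$, \[ \mathrm{ex}_\Pi\big(n, s, \Sigma_{T}(s)\big) = \Pi_{T}(n)^{1+o(1)}, \] where $o(1)\to 0$ as $n\to\infty$.
   Context: A multigraph $G=(V,w)$ is a finite vertex set $V$ together with $w\colon\binom{V}{2}\to\mathbb{Z}_{\ge0}$. For $X\subseteq V$, $e(X)=\sum_{uv\in\binom X2}w(uv)$, $P(X)=\prod_{uv\in\binom X2}w(uv)$, $e(G)=e(V)$, $P(G)=P(V)$. $G$ is an $(s,q)$-graph if $e(X)\le q$ for every $s$-set $X\subseteq V$. $\mathrm{ex}_\Pi(n,s,q)$ is the maximum of $P(G)$ over $(s,q)$-graphs $G$ on vertex set $[n]$. A pattern $P$ on a finite set $V(P)$ assigns non-negative integer multiplicities $P(\{v\})$ to vertices (loops) and $P(\{u,v\})$ to pairs. A blow-up of $P$ on $[n]$ is a multigraph on $[n]$ with a map $f\colon[n]\to V(P)$ (not necessarily surjective) such that $w(vv')=P(\{f(v),f(v')\})$ for all distinct $v,v'$ (a loop multiplicity if $f(v)=f(v')$). $\Sigma_P(n)$ and $\Pi_P(n)$ are the maximum of $e(G)$ and of $P(G)$, respectively, over blow-ups $G$ of $P$ on $[n]$. Generalised Turán pattern: for a $(d+1)$-tuple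 $\mathbf{r}=(r_0,\dots,r_d)$ of non-negative integers with $r_0,r_d>0$ and integer $a$, with $R=\sum_ir_i$, $T^a_{\mathbf{r}}$ is the pattern on $[R]$ where for $v$ with $\sum_{i<j}r_i<v\le\sum_{i\le j}r_i$ the loop at $v$ has multiplicity $a-j$ and each pair $\{v,v'\}$ with $v<v'\le R$ has multiplicity $a-j+1$. *)

(* Defs.v *)
From mathcomp Require Import all_boot all_classical.

Set Implicit Arguments.
Unset Strict Implicit.
Unset Printing Implicit Defensive.

Local Open Scope nat_scope.
Local Open Scope set_scope.

(* The multiplicity function w.  Only its values at the 2-element subsets of V
   are ever used; the other values are irrelevant. *)
Definition multigraph (V : finType) := {set V} -> nat.

(* The pair {u, v} (u != v) has multiplicity P [set u; v] and the loop at v has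
   multiplicity P [set v]; the other values are irrelevant. *)
Definition pattern (V : finType) := {set V} -> nat.

Section Multigraph.
Variable V : finType.
Implicit Types (G : multigraph V) (X : {set V}).

Definition edge_sum_in G X : nat :=
  \sum_(uv : {set V} | (uv \subset X) && (#|uv| == 2)) G uv.

Definition edge_prod_in G X : nat :=
  \prod_(uv : {set V} | (uv \subset X) && (#|uv| == 2)) G uv.

Definition edge_sum G : nat := edge_sum_in G [set: V].

Definition edge_prod G : nat := edge_prod_in G [set: V].

Definition sq_graph (s q : nat) G : Prop :=
  forall X, #|X| = s -> edge_sum_in G X <= q.

End Multigraph.

(* The maximum of a set of natural numbers; junk value 0 if it has none. *)
Definition max_set (A : set nat) : nat :=
  xget 0 (fun m => A m /\ forall k, A k -> k <= m).

(* The maximum exists as soon as 2 <= s <= n.  For n < s the condition on G is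
   vacuous, so for n >= 2 there is no maximum and the value is the junk 0. *)
Definition ex_Pi (n s q : nat) : nat :=
  max_set (fun m => exists G : multigraph 'I_n, sq_graph s q G /\ edge_prod G = m).

Section Blowup.
Variables (V : finType) (P : pattern V).

Definition blowup (n : nat) (f : {ffun 'I_n -> V}) : multigraph 'I_n :=
  fun uv => P (f @: uv).

(* If f u = f v then [set f u; f v] = [set f u], the loop at f u. *)
Lemma blowupE (n : nat) (f : {ffun 'I_n -> V}) (u v : 'I_n) :
  blowup f [set u; v] = P [set f u; f v].
Proof. by rewrite /blowup imsetU !imset_set1. Qed.

Definition Sigma_pat (n : nat) : nat :=
  \max_(f : {ffun 'I_n -> V}) edge_sum (blowup f).

Definition Pi_pat (n : nat) : nat :=
  \max_(f : {ffun 'I_n -> V}) edge_prod (blowup f).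

End Blowup.

Section Turan.
Variables (r : seq nat) (a : nat).

(* The j such that vertex v lies in the j-th block of sizes r; vertices are
   numbered from 0, whence the shifted inequalities in turan_blockP. *)
Definition turan_block (v : 'I_(sumn r)) : nat := reshape_index r v.

(* The enumeration of a set of ordinals is increasing, so v < v' in the second
   case.  The subtraction is the true one provided size r <= a.+1. *)
Definition turan_pattern : pattern 'I_(sumn r) := fun e =>
  match enum e with
  | [:: v] => a - turan_block v
  | [:: v; _] => a - turan_block v + 1
  | _ => 0
  end.

Lemma turan_blockP (v : 'I_(sumn r)) (j : nat) : j < size r ->
  reflect (turan_block v = j)
          (sumn (take j r) <= v < sumn (take j.+1 r)).
Proof.
move=> jr; have tkS k : k < size r ->
    sumn (take k.+1 r) = sumn (take k r) + nth 0 r k.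
  by move=> kr; rewrite (take_nth 0 kr) sumn_rcons.
apply: (iffP andP) => [[lo hi]|<-].
  have c : v - sumn (take j r) < nth 0 r j by rewrite ltn_subLR // -tkS.
  have := flatten_indexKl c.
  by rewrite /flatten_index subnKC.
have vr := ltn_ord v.
rewrite tkS ?reshape_indexP //.
have := reshape_offsetP vr; have := reshape_indexK r v.
rewrite /flatten_index /turan_block; move=> vE oP.
by split; [rewrite -[leqRHS]vE leq_addr | rewrite -[ltnLHS]vE ltn_add2l].
Qed.

Lemma turan_loop (v : 'I_(sumn r)) : turan_pattern [set v] = a - turan_block v.
Proof. by rewrite /turan_pattern enum_set1. Qed.

Lemma turan_pair (v v' : 'I_(sumn r)) : v < v' ->
  turan_pattern [set v; v'] = a - turan_block v + 1.
Proof.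
move=> vv'; rewrite /turan_pattern.
suff -> : enum [set v; v'] = [:: v; v'] by [].
apply: (inj_map val_inj); apply: (irr_sorted_eq ltn_trans ltnn).
- rewrite sorted_map {1}/enum_mem -enumT; apply: sorted_filter.
    by move=> x y z; apply: ltn_trans.
  by rewrite -sorted_map val_enum_ord iota_ltn_sorted.
- by rewrite /= vv'.
move=> x; apply/mapP/mapP => -[y yin ->]; exists y => //;
  by move: yin; rewrite mem_enum !inE.
Qed.

End Turan.

Arguments turan_pattern r a _ : clear implicits.

(* Main.v *)
(* Write p = d rd + 1, N = r0 p + rd, and let the deficit of a pair be a + 1 minus
   its multiplicity. Every blow-up of T on t vertices has total deficit at least
   E(t) = sum_(i < t) floor(p i / N). Call lam the common logarithmic degree of
   the vertices of T under its optimal weighting. Choosing types greedily shows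
   ln Pi_T(n) >= lam n(n-1)/2, and blow-ups of T are (s, Sigma_T(s))-graphs.

   For the upper bound, delete vertices one by one: it suffices that a large
   (s, Sigma_T(s))-graph has a vertex of logarithmic degree at most lam + eps per
   vertex. If not, averaging shows that for every bounded weighted set of vertices
   some new vertex sends to it a logarithmic degree above lam on average, hence, a
   being large, a deficit of at most floor(p k / N) to any list of length k. It
   follows that t-sets have deficit at least E(t) for all t <= s, and a greedy
   choice gives an N-set X with deficit exactly E(N). Every outside vertex sends
   deficit at least p to X, so vertices sending exactly p, even to boundedly many
   such N-sets at once, exist; exchanging vertices of X for these reveals r0
   classes of p + 1 vertices with deficit 1 inside and 0 between classes, and then
   rd further vertices with pairwise deficit d and deficit 0 to the classes. A new
   vertex can send at most lam on weighted average to this core: a contradiction. *)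
Require Import Defs.
From mathcomp Require Import all_boot all_order all_algebra.
From mathcomp Require Import all_classical all_reals all_analysis.
From mathcomp Require Import zify ring lra.

Set Implicit Arguments.
Unset Strict Implicit.
Unset Printing Implicit Defensive.

(** * Pair sums along lists *)

Definition deg (V : Type) (c : V -> V -> nat) (l : seq V) (v : V) : nat :=
  \sum_(u <- l) c u v.

Fixpoint psum (V : Type) (c : V -> V -> nat) (l : seq V) : nat :=
  if l is x :: l' then deg c l' x + psum c l' else 0.

(** Greedy deficit: the vertex of index [i] sends an integer amount, at most [p * i / N], to its
    predecessors, whence the floor. *)
Definition incr_sum (p N t : nat) : nat := \sum_(0 <= i < t) (p * i) %/ N.

Lemma incr_sumS p N t : incr_sum p N t.+1 = incr_sum p N t + (p * t) %/ N.
Proof. by rewrite /incr_sum big_nat_recr. Qed.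

Lemma leq_sum_const (T : eqType) (l : seq T) (F : T -> nat) k :
  {in l, forall x, F x <= k} -> \sum_(x <- l) F x <= k * size l.
Proof.
elim: l => [|x l IH] H; first by rewrite big_nil.
rewrite big_cons /= mulnS leq_add ?H ?mem_head // IH // => y yl.
by rewrite H // inE yl orbT.
Qed.

Section PairSums.
Variables (V : eqType) (c : V -> V -> nat).
Hypothesis csym : forall u v, c u v = c v u.

Lemma deg_cons x l v : deg c (x :: l) v = c x v + deg c l v.
Proof. by rewrite /deg big_cons. Qed.

Lemma deg_cat l1 l2 v : deg c (l1 ++ l2) v = deg c l1 v + deg c l2 v.
Proof. by rewrite /deg big_cat. Qed.

Lemma deg_rem u l v : u \in l -> deg c l v = c u v + deg c (rem u l) v.
Proof.
by move=> ul; rewrite -deg_cons /deg (perm_big _ (perm_to_rem ul)).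
Qed.

Lemma deg_flatten ls v : deg c (flatten ls) v = \sum_(l <- ls) deg c l v.
Proof.
by elim: ls => [|l ls IH]; rewrite /= ?big_nil ?big_cons ?deg_cat ?IH // /deg big_nil.
Qed.

Lemma deg_const l v k : (forall u, u \in l -> c u v = k) -> deg c l v = k * size l.
Proof.
move=> H; rewrite /deg big_seq (eq_bigr (fun=> k)) //.
by rewrite -big_seq big_const_seq count_predT iter_addn_0.
Qed.

Lemma deg_ge l v k : (forall u, u \in l -> k <= c u v) -> k * size l <= deg c l v.
Proof.
elim: l => [|x l IH] H; first by rewrite muln0.
rewrite deg_cons /= mulnS leq_add ?H ?mem_head // IH // => u ul.
by rewrite H // inE ul orbT.
Qed.

Lemma deg_mem u l v : u \in l -> c u v <= deg c l v.
Proof. by move=> /deg_rem ->; rewrite leq_addr. Qed.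

(** Each pair of positions is seen from both ends, and [deg c l u] also counts [u] against itself,
    which the diagonal sum repays. The identity makes [psum] invariant under permutations. *)
Lemma psum_double l : 2 * psum c l + \sum_(u <- l) c u u = \sum_(u <- l) deg c l u.
Proof.
elim: l => [|x l IH]; first by rewrite !big_nil.
rewrite /= !big_cons deg_cons.
under [X in _ = _ + X]eq_bigr do rewrite deg_cons.
rewrite big_split /= -IH.
have -> : \sum_(i <- l) c x i = deg c l x by apply: eq_bigr => i _; rewrite csym.
lia.
Qed.

Lemma psum_perm l1 l2 : perm_eq l1 l2 -> psum c l1 = psum c l2.
Proof.
move=> l12; have := psum_double l1; have := psum_double l2.
rewrite !(perm_big _ l12) /=.
have -> : \sum_(u <- l2) deg c l1 u = \sum_(u <- l2) deg c l2 u.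
  by apply: eq_bigr => u _; rewrite /deg (perm_big _ l12).
lia.
Qed.

Lemma psum_rem u l : u \in l -> psum c l = deg c (rem u l) u + psum c (rem u l).
Proof. by move=> /perm_to_rem/psum_perm ->. Qed.

Lemma psum_cat l1 l2 :
  psum c (l1 ++ l2) = psum c l1 + psum c l2 + \sum_(u <- l1) deg c l2 u.
Proof.
elim: l1 => [|x l1 IH] /=; first by rewrite big_nil addn0.
rewrite deg_cat IH big_cons; lia.
Qed.

Lemma sum_deg_rem l : \sum_(u <- l) deg c (rem u l) u = 2 * psum c l.
Proof.
apply: (@addIn (\sum_(u <- l) c u u)); rewrite psum_double -big_split /=.
by rewrite big_seq [RHS]big_seq; apply: eq_bigr => u /deg_rem ->; rewrite addnC.
Qed.

Lemma psum_const l k : uniq l ->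
  (forall x y, x \in l -> y \in l -> x != y -> c x y = k) ->
  psum c l = k * 'C(size l, 2).
Proof.
elim: l => [|x l IH] /= => [_ _|/andP[xl ul] H]; first by rewrite muln0.
rewrite (@deg_const _ _ k) => [|u u_l]; last first.
  by apply: H; rewrite ?mem_head ?inE ?u_l ?orbT //; apply: contraNneq xl => <-.
rewrite IH // => [|y z yl zl]; last by apply: H; rewrite inE ?yl ?zl orbT.
by rewrite binS bin1; lia.
Qed.

End PairSums.

(** * Floor sums: the values of [E] over one period *)

Section IncrSum.
Variables (r0 rd d : nat).
Hypotheses (r0_gt0 : 0 < r0) (rd_gt0 : 0 < rd) (d_gt0 : 0 < d).
Notation p := (d * rd).+1.
Notation N := (r0 * p + rd).
Notation E := (incr_sum p N).

Lemma period_gt : p < N. Proof. nia. Qed.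

Lemma incr_sum_period : E N.+1 = E N + p.
Proof. by rewrite incr_sumS mulnK //; have := period_gt; lia. Qed.

Lemma incr_sum_pred_period : E N = E N.-1 + p.-1.
Proof.
have NP := period_gt.
have := incr_sumS p N N.-1; rewrite prednK; last by lia.
move=> ->; congr (_ + _).
have -> : p * N.-1 = p.-1 * N + (N - p) by nia.
by rewrite divnMDl ?divn_small ?addn0; lia.
Qed.

(* The terms of index i and N - i add up to at least p - 1. *)
Lemma incr_sum_period_ge : p.-1 * N.-1 <= 2 * E N.
Proof.
have NP := period_gt; have N0 : 0 < N by lia.
have shift : E N = \sum_(1 <= i < N) (p * i) %/ N.
  by rewrite /incr_sum big_ltn // muln0 div0n.
have : E N + E N = \sum_(1 <= i < N) ((p * i) %/ N + (p * (N - i)) %/ N).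
  rewrite big_split /= {1}shift shift; congr (_ + _).
  by rewrite big_nat_rev; apply: eq_bigr => i _; rewrite add1n subSS.
rewrite addnn -mul2n => ->.
have -> : p.-1 * N.-1 = \sum_(1 <= i < N) p.-1.
  by rewrite sum_nat_const_nat subn1 mulnC.
rewrite !big_nat; apply: leq_sum => i /andP[i1 iN].
have h1 := ltn_ceil (p * i) N0; have h2 := ltn_ceil (p * (N - i)) N0.
move: h1 h2; set q1 := _ %/ _; set q2 := _ %/ _ => h1 h2.
have : p * N < (q1 + q2).+2 * N.
  rewrite -[X in p * X](subnKC (ltnW iN)) mulnDr.
  have -> : (q1 + q2).+2 * N = q1.+1 * N + q2.+1 * N.
    by rewrite -mulnDl addSn addnS.
  by apply: leq_ltn_trans (leq_add (ltnW h1) (leqnn _)) _; rewrite ltn_add2l.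
by rewrite ltn_pmul2r //; lia.
Qed.

(** The terms are nondecreasing: from an index where [m] is reached, each further term contributes
    at least [m]. *)
Lemma incr_sum_add x k m : m * N <= p * x -> E x + k * m <= E (x + k).
Proof.
move=> H; elim: k => [|k IH]; first by rewrite addn0 mul0n addn0.
rewrite addnS incr_sumS mulSn addnCA addnC leq_add // leq_divRL; nia.
Qed.

(** The run of [r0] indices starting at [r0 * m + 1] has terms at least [m], because [m * rd <= p]
    while [m <= d]. *)
Lemma incr_sum_first_period m : m <= d -> r0 * 'C(m, 2) <= E (r0 * m).+1.
Proof.
elim: m => [|m IH] md; first by rewrite muln0.
have -> : (r0 * m.+1).+1 = (r0 * m).+1 + r0 by lia.
apply: leq_trans (@incr_sum_add _ r0 m _); last by nia.
by rewrite binS bin1 mulnDr leq_add ?IH // ltnW.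
Qed.

Lemma incr_sum_second_block : r0 * 'C(d, 2) + d <= E (r0 * d).+2.
Proof.
rewrite incr_sumS leq_add ?incr_sum_first_period // leq_divRL; nia.
Qed.

End IncrSum.

(** * Locating the core *)

Lemma seq_argmax (T : eqType) (F : T -> nat) (l : seq T) : l != [::] ->
  exists2 x, x \in l & {in l, forall y, F y <= F x}.
Proof.
elim: l => // x [|y l] IH _.
  by exists x; rewrite ?mem_head // => z; rewrite inE => /eqP ->.
have [//|z zl zmax] := IH; case: (leqP (F x) (F z)) => xz.
  exists z; first by rewrite inE zl orbT.
  by move=> w; rewrite inE => /predU1P[->|/zmax].
exists x; rewrite ?mem_head // => w; rewrite inE => /predU1P[->//|/zmax wz].
exact: leq_trans wz (ltnW xz).
Qed.

Section Core.
Variables (V : eqType) (c : V -> V -> nat) (r0 rd d : nat) (x0 : V).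
Hypothesis csym : forall u v, c u v = c v u.
Hypotheses (r0_gt0 : 0 < r0) (rd_gt0 : 0 < rd) (d_gt0 : 0 < d).
Variables (p N : nat).
Hypotheses (pE : p = (d * rd).+1) (NE : N = r0 * p + rd).
Notation E := (incr_sum p N).
(** [M] is the total size of the [r0] classes. A history is extended at most [N * N] times by at
    most [M] vertices, and [hmax] leaves room for the classes themselves. [K] exceeds [p * size l]
    for every list [l] of length at most [p * N]. *)
Notation M := (r0 * p.+1).
Notation hmax := (M * (N * N) + M).
Notation K := (p * (p * N)).+1.
Notation B := (K * (N * (hmax * N).+1) + p * N).
(* [B] bounds the length of all lists to which [low_deg] gets applied. *)
Hypothesis c_sparse : forall l, uniq l -> size l <= N.+1 -> E (size l) <= psum c l.
Hypothesis low_deg : forall l, 0 < size l <= B ->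
  exists2 v, v \notin l & N * deg c l v <= p * size l.

Let p_gt0 : 0 < p. Proof. by rewrite pE. Qed.
Let p_lt_N : p < N. Proof. by rewrite NE pE period_gt. Qed.
Let N_gt0 : 0 < N. Proof. exact: leq_trans p_lt_N. Qed.
Let M_gt0 : 0 < M. Proof. by rewrite muln_gt0 r0_gt0. Qed.
Let EN1 : E N.+1 = E N + p.
Proof. by rewrite NE pE incr_sum_period. Qed.
Let ENpred : E N = E N.-1 + p.-1.
Proof. by rewrite NE pE incr_sum_pred_period. Qed.
Let EN_ge : p.-1 * N.-1 <= 2 * E N.
Proof. by rewrite NE pE incr_sum_period_ge. Qed.
Let E_second : r0 * 'C(d, 2) + d <= E (r0 * d).+2.
Proof. by rewrite NE pE incr_sum_second_block. Qed.

Definition tight (Y : seq V) := [&& uniq Y, size Y == N & psum c Y == E N].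

(** Adding [v] gives [N.+1] vertices, and [E] grows by exactly [p] from [N] to [N.+1]. *)
Lemma tight_deg Y v : tight Y -> v \notin Y -> p <= deg c Y v.
Proof.
case/and3P=> uY /eqP sY /eqP pY vY.
have := @c_sparse (v :: Y); rewrite /= vY uY sY pY EN1.
by move=> /(_ isT (leqnn _)); rewrite addnC leq_add2r.
Qed.

Lemma tight_exists : exists X, tight X.
Proof.
have NB : N <= B by apply: leq_trans (leq_addl _ _); rewrite leq_pmull.
suff /(_ N) [] : forall t, 0 < t <= N ->
    exists l, [/\ uniq l, size l = t & psum c l <= E t].
- by rewrite leqnn andbT; lia.
- move=> X [uX sX pX]; exists X; rewrite /tight uX sX eqxx /= eqn_leq pX /=.
  by have := c_sparse uX; rewrite sX leqnSn; apply.
elim=> // -[|t] IH tN; first by exists [:: x0]; rewrite /= /deg big_nil.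
have [|l [ul sl pl]] := IH; first by lia.
have [|v vl dv] := @low_deg l; first by rewrite sl; lia.
exists (v :: l); rewrite /= vl ul sl; split=> //.
rewrite incr_sumS addnC leq_add // leq_divRL; last lia.
by rewrite mulnC -sl.
Qed.

(** [low_deg] is applied to [K] copies of all lists of [F] followed by [l]. Each tight list receives
    at least [p], which is already the allowed average; a single unit of excess would be multiplied
    by [K] and exceed what [l] can compensate. Hence all receive exactly [p], and cancelling them
    leaves the bound for [l]. *)
Lemma common_low_deg (F : seq (seq V)) (l : seq V) :
  0 < size F <= (hmax * N).+1 -> {in F, forall Y, tight Y} -> size l <= p * N ->
  exists v, [/\ v \notin flatten F, v \notin l,
    {in F, forall Y, deg c Y v = p} & N * deg c l v <= p * size l].
Proof.
move=> /andP[F0 FB] tF lB.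
have sF : size (flatten F) = N * size F.
  rewrite size_flatten /shape sumnE big_map big_seq (eq_bigr (fun=> N)).
    by rewrite -big_seq big_const_seq count_predT iter_addn_0.
  by move=> Y /tF /and3P[_ /eqP].
pose L := flatten (nseq K (flatten F)) ++ l.
have sL : size L = K * (N * size F) + size l.
  rewrite size_cat -sF; congr (_ + _).
  by elim: (K) => //= k IH; rewrite size_cat IH mulSn.
have [|v] := @low_deg L.
  by rewrite sL leq_add ?leq_mul // andbT addn_gt0 !muln_gt0 N_gt0 F0.
rewrite mem_cat negb_or sL => /andP[vF vl].
have {}vF : v \notin flatten F by move: vF; rewrite /= mem_cat negb_or => /andP[].
have vY Y : Y \in F -> v \notin Y.
  by move=> YF; apply: contra vF => vY; apply/flattenP; exists Y.
have -> : deg c L v = K * deg c (flatten F) v + deg c l v.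
  rewrite deg_cat; congr (_ + _).
  elim: (K) => [|k IH]; first by rewrite /deg big_nil.
  by rewrite /= deg_cat IH mulSn.
have FG : p * size F <= deg c (flatten F) v.
  rewrite deg_flatten; elim: (F) tF vY => [|Y G IH] tF vY; first by rewrite muln0.
  rewrite big_cons /= mulnS leq_add ?tight_deg ?tF ?vY ?mem_head //.
  by rewrite IH // => Z ZG; [apply: tF | apply: vY]; rewrite inE ZG orbT.
have lK : p * size l < K by rewrite ltnS leq_mul.
move: (K) lK => k lk.
move: (deg c (flatten F) v) (deg_flatten c F v) FG => D DE FG H.
have DF : D = p * size F.
  apply/eqP; rewrite eqn_leq FG andbT leqNgt; apply/negP => lt.
  have : N * (k * (p * size F).+1) <= p * (k * (N * size F) + size l).
    apply: leq_trans H; rewrite leq_mul2l (leq_trans _ (leq_addr _ _)) ?orbT //.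
    by rewrite leq_mul2l lt orbT.
  have -> : N * (k * (p * size F).+1) = p * (k * (N * size F)) + N * k by lia.
  rewrite mulnDr leq_add2l leqNgt (leq_trans lk) //.
  exact: leq_pmull.
exists v; split=> //; last first.
  move: H; rewrite DF.
  have -> : N * (k * (p * size F) + deg c l v) =
            p * (k * (N * size F)) + N * deg c l v by lia.
  by rewrite mulnDr leq_add2l.
move=> Y YF; apply/eqP; rewrite eqn_leq tight_deg ?vY ?tF // andbT.
move: DE; rewrite DF (big_rem Y) //=.
have : p * size (rem Y F) <= \sum_(l0 <- rem Y F) deg c l0 v.
  have : {subset rem Y F <= F} by move=> Z /mem_rem.
  elim: (rem Y F) => [|Z G IH] sub; first by rewrite muln0.
  rewrite big_cons /= mulnS leq_add ?tight_deg ?tF ?vY ?sub ?mem_head //.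
  by apply: IH => W WG; apply: sub; rewrite inE WG orbT.
rewrite size_rem // => h; case: (size F) F0 h => // f _; rewrite mulnS /=; lia.
Qed.

(** The members of [us] are only labels: [u] need not belong to [cls u]. *)
Definition classes (us : seq V) (cls : V -> seq V) := [/\ uniq us, size us = r0,
  {in us, forall u, uniq (cls u) /\ size (cls u) = p.+1},
  {in us &, forall u u' x, x \in cls u -> x \in cls u' -> u = u'} &
  {in us &, forall u u' x y, x \in cls u -> y \in cls u' -> x != y ->
     c x y = (u == u')}].

Lemma psum_blocks us (L : V -> seq V) q : uniq us ->
  {in us, forall u, uniq (L u) /\ size (L u) = q} ->
  {in us &, forall u u' x, x \in L u -> x \in L u' -> u = u'} ->
  {in us &, forall u u' x y, x \in L u -> y \in L u' -> x != y -> c x y = (u == u')} ->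
  [/\ uniq (flatten [seq L u | u <- us]),
      size (flatten [seq L u | u <- us]) = size us * q &
      psum c (flatten [seq L u | u <- us]) = size us * 'C(q, 2)].
Proof.
elim: us => [|u us IH] //= /andP[uus uniqus] sL dis cL.
have sub x : x \in us -> x \in u :: us by rewrite inE => ->; rewrite orbT.
have [||||ufl sfl pfl] := IH.
- by [].
- by move=> x /sub; apply: sL.
- by move=> x y /sub xu /sub yu; apply: dis.
- by move=> x y /sub xu /sub yu; apply: cL.
have [uLu sLu] := sL u (mem_head _ _).
have cross x y : x \in L u -> y \in flatten [seq L u0 | u0 <- us] -> x != y /\ c x y = 0.
  move=> xL /flatten_mapP[u' u'us yL].
  have ne : u != u' by apply: contraNneq uus => ->.
  have xy : x != y.
    apply: contraNneq ne => xy; apply/eqP.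
    by apply: (dis _ _ (mem_head _ _) (sub _ u'us) x); rewrite // xy.
  by split=> //; rewrite (cL u u') ?mem_head ?sub // (negPf ne).
split.
- rewrite cat_uniq uLu ufl andbT /=; apply/hasPn => y yf; apply/negP => yL.
  by have [] := cross y y yL yf; rewrite eqxx.
- by rewrite size_cat sLu sfl mulSn.
rewrite psum_cat // pfl (@psum_const _ _ _ 1) //; last first.
  by move=> x y xL yL xy; rewrite (cL u u) ?mem_head // eqxx.
rewrite sLu mul1n mulSn [X in _ + X]big1_seq ?addn0 // => x /= xL.
by rewrite (@deg_const _ _ _ _ 0) // => y yf; rewrite csym; case: (cross x y xL yf).
Qed.

Lemma classes_sub us cls (L : V -> seq V) q : classes us cls ->
  {in us, forall u, [/\ uniq (L u), size (L u) = q & {subset L u <= cls u}]} ->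
  [/\ uniq (flatten [seq L u | u <- us]),
      size (flatten [seq L u | u <- us]) = r0 * q &
      psum c (flatten [seq L u | u <- us]) = r0 * 'C(q, 2)].
Proof.
move=> [uus <- _ dis cc] sL; apply: psum_blocks => //.
- by move=> u /sL[].
- move=> u u' uu uu' x xL xL'; apply: (dis _ _ uu uu' x).
    by case: (sL u uu) => _ _; apply.
  by case: (sL u' uu') => _ _; apply.
- move=> u u' uu uu' x y xL yL; apply: cc => //.
    by case: (sL u uu) => _ _; apply.
  by case: (sL u' uu') => _ _; apply.
Qed.

(** Take [d] vertices from each class together with [v] and [w]: these [r0 * d + 2] vertices have
    deficit [r0 * 'C(d, 2) + c w v], while sparsity demands at least [r0 * 'C(d, 2) + d]. *)
Lemma far_pair us cls (L : V -> seq V) v w : classes us cls ->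
  {in us, forall u, [/\ uniq (L u), d <= size (L u) & {subset L u <= cls u}]} ->
  {in us, forall u x, x \in L u -> [/\ x != v, x != w, c x v = 0 & c x w = 0]} ->
  v != w -> d <= c w v.
Proof.
move=> cl sL zL vw; pose L' u := take d (L u).
have [u /sL[uL dL sub]|ufl sfl pfl] := @classes_sub us cls L' d cl.
  by rewrite take_uniq // size_takel //; split=> // x /mem_take /sub.
have zf x : x \in flatten [seq L' u | u <- us] ->
    [/\ x != v, x != w, c x v = 0 & c x w = 0].
  by move=> /flatten_mapP[u uu /mem_take]; apply: zL.
have := @c_sparse [:: v, w & flatten [seq L' u | u <- us]].
rewrite /= ufl sfl pfl inE negb_or vw andbT /= deg_cons.
rewrite !(@deg_const _ _ _ _ 0); try by move=> x /zf[].
move=> H; have := leq_trans E_second (H _ _).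
rewrite mul0n addn0 add0n addnC leq_add2r; apply.
  by apply/andP; split; apply/negP => /zf[]; rewrite ?eqxx.
by rewrite ltnS NE -addn1 leq_add // leq_mul2l pE leqW ?orbT // leq_pmulr.
Qed.

(** The [N] chosen vertices have deficit [r0 * 'C(p, 2) + d * 'C(rd, 2)], which is half of
    [p.-1 * N.-1] and so at most [E N]. Adding [v] must raise it to at least [E N + p]. *)
Lemma period_deg us cls (L : V -> seq V) ws v : classes us cls ->
  {in us, forall u, [/\ uniq (L u), size (L u) = p & {subset L u <= cls u}]} ->
  uniq ws -> size ws = rd -> {in ws &, forall w w', w != w' -> c w w' = d} ->
  {in ws, forall w, {in us, forall u x, x \in L u -> x != w /\ c x w = 0}} ->
  v \notin flatten [seq L u | u <- us] -> v \notin ws ->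
  p <= deg c (flatten [seq L u | u <- us]) v + deg c ws v.
Proof.
move=> cl sL uws sws cws zws vf vws.
have [ufl sfl pfl] := classes_sub cl sL.
set f := flatten _ in ufl sfl pfl vf *.
have zf w x : w \in ws -> x \in f -> x != w /\ c x w = 0.
  by move=> wws /flatten_mapP[u uu]; apply: zws.
have := @c_sparse (v :: ws ++ f).
rewrite /= mem_cat negb_or vf vws cat_uniq uws ufl size_cat sws sfl addnC -NE leqnn.
rewrite EN1 deg_cat psum_cat // pfl (psum_const uws cws) sws andbT.
rewrite big1_seq => [|x /= xws]; last by rewrite (@deg_const _ _ _ _ 0) // => y /(zf x)[].
have -> /= : ~~ has (mem ws) f.
  by apply/hasPn => x xf; apply/negP => /= xws; have [] := zf _ _ xws xf; rewrite eqxx.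
move=> /(_ isT isT).
have := EN_ge.
have e1 : 2 * 'C(rd, 2) = rd * rd.-1 by rewrite -mul_bin_diag bin1.
have e2 : 2 * 'C(p, 2) = p * p.-1 by rewrite -mul_bin_diag bin1.
have : p.-1 * N.-1 = r0 * (p * p.-1) + d * (rd * rd.-1).
  by rewrite NE pE /=; case: (rd) rd_gt0 => // r _; rewrite addnS /=; lia.
rewrite -e1 -e2; lia.
Qed.

(** * Exchanging vertices of a tight list *)

Section TightSet.
Variable X : seq V.
Hypothesis tX : tight X.

Let uX : uniq X. Proof. by case/and3P: tX. Qed.
Let sX : size X = N. Proof. by case/and3P: tX => _ /eqP. Qed.
Let pX : psum c X = E N. Proof. by case/and3P: tX => _ _ /eqP. Qed.

Definition saturated := [seq u <- X | deg c (rem u X) u == p.-1].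

(** What remains after deleting [u] still has deficit at least [E N.-1], which is [E N - p.-1]. *)
Lemma deg_tight_le u : u \in X -> deg c (rem u X) u <= p.-1.
Proof.
move=> uin; have := @c_sparse (rem u X); rewrite rem_uniq // size_rem // sX.
have := psum_rem csym uin; rewrite pX ENpred.
move=> + /(_ isT); lia.
Qed.

(** The degrees inside [X] sum to [2 * E N], at least [p.-1 * N.-1], and none exceeds [p.-1]; so at
    most [p.-1] of the [N] vertices fall short of the maximum. *)
Lemma size_saturated : (r0.-1 * p + rd).+1 <= size saturated.
Proof.
pose b u := deg c (rem u X) u == p.-1.
have := sum_deg_rem csym X; rewrite pX => S2.
have := EN_ge; rewrite -S2.
have : \sum_(u <- X) deg c (rem u X) u + count (predC b) X <= p.-1 * N.
  have -> : p.-1 * N = \sum_(u <- X) p.-1.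
    by rewrite big_const_seq count_predT iter_addn_0 sX.
  rewrite -sum1_count [X in _ + X]big_mkcond -big_split /=.
  rewrite big_seq [leqRHS]big_seq; apply: leq_sum => u uin.
  by have := deg_tight_le uin; rewrite /b /=; case: eqP => /=; lia.
have := count_predC b X; rewrite sX size_filter -/b.
have -> : p.-1 * N = p.-1 * N.-1 + p.-1 by rewrite -mulnSr prednK.
have : N = r0.-1 * p + p + rd by rewrite NE -mulSnr prednK.
lia.
Qed.

Lemma saturated_sub u : u \in saturated -> u \in X.
Proof. by rewrite mem_filter => /andP[]. Qed.

(** Exchanging [u] for [v] changes the deficit [E N] by [p - p.-1 - c u v], and the result may not
    drop below [E N]. Equality, when [c u v = 1], makes the exchanged list tight. *)
Lemma saturated_le1 u v : u \in saturated -> v \notin X -> deg c X v = p ->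
  c u v <= 1.
Proof.
rewrite mem_filter => /andP[/eqP du uin] vX dv.
have := @c_sparse (v :: rem u X).
rewrite /= rem_uniq // size_rem // sX prednK // leqnSn (contra (@mem_rem _ _ _ _)) //.
move=> /(_ isT isT).
have := psum_rem csym uin; have := deg_rem c v uin.
rewrite pX dv du; lia.
Qed.

Lemma tight_swap u v : u \in saturated -> v \notin X -> deg c X v = p ->
  c u v = 1 -> tight (v :: rem u X).
Proof.
rewrite mem_filter => /andP[/eqP du uin] vX dv cuv.
rewrite /tight /= rem_uniq // size_rem // sX prednK // eqxx.
rewrite (contra (@mem_rem _ _ _ _)) //=.
have := psum_rem csym uin; have := deg_rem c v uin.
rewrite pX dv du; lia.
Qed.

(* For w in h with c u w = 1 the exchange of u for w in X is again tight, so a vertex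
   sending exactly p to all these tight lists cannot distinguish w from u. *)
Definition generic h v := [/\ v \notin X ++ h, deg c X v = p &
  forall w u, w \in h -> u \in saturated -> c u w = 1 -> c w v = c u v].

(** The newest vertex stands at the head, so each vertex is generic over the older ones. The
    saturated vertex at deficit 1 provides an exchange that keeps [X] tight. *)
Fixpoint history h := if h is v :: h' then
  [/\ generic h' v, has (fun u => c u v == 1) saturated & history h'] else True.

Lemma history_mem h v : history h -> v \in h ->
  [/\ v \notin X, deg c X v = p & has (fun u => c u v == 1) saturated].
Proof.
elim: h => //= w h IH [[+ dw _] uw /IH hw]; rewrite inE mem_cat negb_or.
by case/andP=> wX _ /predU1P[->|/hw].
Qed.

Lemma history_uniq h : history h -> uniq h.
Proof.
elim: h => //= w h IH [[+ _ _] _ /IH ->]; rewrite mem_cat negb_or andbT.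
by case/andP.
Qed.

(** The newer of the two vertices does not distinguish the older one from its saturated partner; the
    two alternatives record which one is newer. *)
Lemma history_pair h v w u u' : history h -> v \in h -> w \in h -> v != w ->
  u \in saturated -> u' \in saturated -> c u v = 1 -> c u' w = 1 ->
  c v w = c u w \/ c v w = c u' v.
Proof.
elim: h => //= x h IH [[xX dx gx] _ hh]; rewrite !inE.
move=> /predU1P[->|vh] /predU1P[->|wh] vw uS u'S cuv cuw.
- by rewrite eqxx in vw.
- by right; rewrite csym (gx w u').
- by left; rewrite (gx v u).
- exact: IH.
Qed.

(** [common_low_deg] is applied to [X] and all its tight one-vertex exchanges with [h]. Sending [p]
    both to [X] and to [w :: rem u X] forces equal deficits to [u] and [w]. *)
Lemma generic_exists h l : history h -> size h <= hmax -> size l <= p * N ->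
  exists v, [/\ generic h v, v \notin l & N * deg c l v <= p * size l].
Proof.
move=> hh hB lB.
pose F := X :: [seq Y <- [seq w :: rem u X | w <- h, u <- saturated] | tight Y].
have [|Y|v [vF vl gF dl]] := @common_low_deg F l _ _ lB.
- rewrite /= ltnS size_filter (leq_trans (count_size _ _)) // size_allpairs.
  by rewrite leq_mul // size_filter -sX count_size.
- by rewrite inE mem_filter => /predU1P[->|/andP[]].
have swapF w u : w \in h -> u \in saturated -> c u w = 1 -> w :: rem u X \in F.
  move=> wh uS cuw; rewrite inE mem_filter; apply/orP; right; apply/andP; split.
    by have [wX dw _] := history_mem hh wh; apply: tight_swap.
  by apply/allpairsP; exists (w, u).
exists v; split=> //; split.
- rewrite mem_cat negb_or; move: (vF); rewrite /= mem_cat negb_or => /andP[-> _] /=.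
  apply: contra vF => vh; have [_ _ /hasP[u uS /eqP cuv]] := history_mem hh vh.
  by apply/flattenP; exists (v :: rem u X); rewrite ?mem_head ?swapF.
- by apply: gF; rewrite mem_head.
- move=> w u wh uS cuw.
  have := gF _ (swapF _ _ wh uS cuw); rewrite deg_cons.
  have := gF X (mem_head _ _); rewrite (deg_rem c v (saturated_sub uS)); lia.
Qed.

(** Taking [rem u X] as the extra list forces less than [p] onto it; as [X] receives exactly [p],
    the vertex [u] gets at least 1, and saturation allows no more. *)
Lemma history_extend h u : history h -> size h <= hmax -> u \in saturated ->
  exists2 v, history (v :: h) & c u v = 1.
Proof.
move=> hh hB uS; have uin := saturated_sub uS.
have [|v [gv _ dl]] := @generic_exists h (rem u X) hh hB.
  by rewrite size_rem // sX (leq_trans (leq_pred _)) // leq_pmull.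
case: (gv) => vXh dv _.
have vX : v \notin X by move: vXh; rewrite mem_cat negb_or => /andP[].
have cuv : c u v = 1.
  have := saturated_le1 uS vX dv; have := deg_rem c v uin.
  have : deg c (rem u X) v < p.
    rewrite -(ltn_pmul2l N_gt0) (leq_ltn_trans dl) // size_rem // sX mulnC.
    by rewrite ltn_pmul2r // ltn_predL.
  rewrite dv; lia.
by exists v => //=; split=> //; apply/hasP; exists u; rewrite ?cuv.
Qed.

Definition related h u u' := has (fun w => (c u w == 1) && (c u' w == 1)) h.

Definition nrelated h :=
  count (fun x => related h x.1 x.2) [seq (u, u') | u <- saturated, u' <- saturated].

Lemma nrelated_le h : nrelated h <= N * N.
Proof.
rewrite (leq_trans (count_size _ _)) // size_allpairs leq_mul //.
all: by rewrite size_filter -sX count_size.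
Qed.

Lemma related_cat e h u u' : related h u u' -> related (e ++ h) u u'.
Proof. by rewrite /related has_cat => ->; rewrite orbT. Qed.

(* Once no bounded extension of h relates new pairs, [related h] is the equivalence
   whose blocks are the traces on [saturated] of all later generic vertices. *)
Definition stable h := forall e, history (e ++ h) -> size e <= M ->
  nrelated (e ++ h) <= nrelated h.

(** Each failure of stability costs at most [M] vertices and relates a new pair, which can happen at
    most [N * N] times. *)
Lemma stable_exists : exists h, [/\ history h, size h <= M * (N * N) & stable h].
Proof.
suff H k h : N * N - nrelated h <= k -> history h -> size h <= M * nrelated h ->
    exists h, [/\ history h, size h <= M * (N * N) & stable h].
  by apply: (H (N * N) [::]); rewrite // leq_subr.
elim: k h => [|k IH] h hk hh sh; have hN := nrelated_le h;
  have shN : size h <= M * (N * N) by rewrite (leq_trans sh) // leq_mul2l hN orbT.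
  exists h; split=> // e _ _; apply: leq_trans (nrelated_le _) _.
  by rewrite -subn_eq0 -leqn0.
have [st|] := EM (stable h); first by exists h.
move=> /existsNP[e] /not_implyP[he] /not_implyP[se] /negP; rewrite -ltnNge => lt.
apply: (IH (e ++ h)) => //; first by lia.
rewrite size_cat; apply: leq_trans (leq_add se sh) _.
by rewrite -mulnS leq_mul2l lt orbT.
Qed.

(** A pair related by [e ++ h] but not by [h] would raise the number of related pairs, since old
    relations persist. *)
Lemma stable_related h e v u u' : stable h -> history (e ++ h) -> size e <= M ->
  v \in e -> u \in saturated -> u' \in saturated -> c u v = 1 -> c u' v = 1 ->
  related h u u'.
Proof.
move=> st he se ve uS u'S cu cu'.
pose s := [seq (x, y) | x <- saturated, y <- saturated].
pose a (x : V * V) := related h x.1 x.2.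
pose b (x : V * V) := related (e ++ h) x.1 x.2.
have ab x : a x -> b x by apply: related_cat.
have : count b s <= count a s by apply: st.
have -> : count b s = count a s + count (predI b (predC a)) s.
  elim: (s) => //= x t ->; have := ab x.
  by case: (a x) (b x) => -[] //=; lia.
move=> cab; have : ~~ has (predI b (predC a)) s by rewrite has_count; lia.
move=> /hasPn/(_ (u, u')) /=; rewrite negb_and negbK; case/(_ _)/orP => //.
  by apply/allpairsP; exists (u, u').
move/negP; case; rewrite /b /related has_cat; apply/orP; left.
by apply/hasP; exists v; rewrite //= cu cu'.
Qed.

Lemma related_eq h v u u' : generic h v -> u \in saturated -> u' \in saturated ->
  related h u u' -> c u v = c u' v.
Proof.
move=> [_ _ gv] uS u'S /hasP[w wh /andP[/eqP cu /eqP cu']].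
by rewrite -(gv w u) // -(gv w u').
Qed.

(** Extend [h] by some [v] with [c u v = 1]. Every vertex related to [u] also has deficit 1 to [v],
    but [X] sends only [p] to [v] in total. *)
Lemma count_related h u : history h -> size h <= M * (N * N) -> stable h ->
  u \in saturated -> related h u u /\ count (related h u) saturated <= p.
Proof.
move=> hh sh st uS.
have [|v hv cuv] := history_extend hh _ uS; first exact: leq_trans (leq_addr _ _).
have gv : generic h v by case: hv.
split.
  exact: (stable_related (e := [:: v]) st hv M_gt0 (mem_head _ _) uS uS cuv cuv).
have [_ <- _] := gv; rewrite count_filter.
apply: leq_trans (_ : count (fun u' => c u' v == 1) X <= _); last first.
  by rewrite -sum1_count big_mkcond; apply: leq_sum => x _; case: eqP => // ->.
apply: leq_trans (_ : count (predI (related h u) (mem saturated)) X <= _).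
  apply/eq_leq/eq_in_count => x xX /=.
  by rewrite mem_filter xX andbT.
apply: sub_count => x /= /andP[ux xS].
by rewrite -(related_eq gv uS xS ux) cuv.
Qed.

(** With fewer than [r0] representatives, their blocks of size at most [p] cover at most [r0.-1 * p]
    vertices, too few to exhaust [saturated]. *)
Lemma unrelated_exists h k : history h -> size h <= M * (N * N) -> stable h ->
  k <= r0 -> exists us, [/\ uniq us, size us = k, {subset us <= saturated} &
    {in us &, forall u u', u != u' -> ~~ related h u u'}].
Proof.
move=> hh sh st; elim: k => [|k IH] kr; first by exists [::].
have [us [uus sus subS nrel]] := IH (ltnW kr).
have [u uS hu] : exists2 u, u \in saturated & all (fun x => ~~ related h x u) us.
  apply: contrapT => no.
  have : size saturated <= \sum_(x <- us) count (related h x) saturated.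
    apply: leq_trans (_ : count (fun u => has (fun x => related h x u) us) saturated <= _).
      rewrite -size_filter -{1}(@filter_predT _ saturated) !size_filter.
      apply/eq_leq/eq_in_count => u uS /=; symmetry.
      apply: contrapT => /negP nh; apply: no; exists u => //.
      by rewrite -all_predC in nh.
    elim: (us) => [|x t IHt]; first by rewrite big_nil leqn0; apply/eqP; exact: count_pred0.
    rewrite big_cons /= -(leq_add2l (count (related h x) saturated)) in IHt *.
    apply: leq_trans IHt; rewrite -count_predUI.
    by apply: leq_trans (leq_addr _ _); apply: sub_count => y /=.
  have : \sum_(x <- us) count (related h x) saturated <= p * size us.
    by apply: leq_sum_const => x /subS xS; have [] := count_related hh sh st xS.
  have := size_saturated; rewrite sus.
  have : k <= r0.-1 by rewrite -ltnS prednK.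
  rewrite -(leq_pmul2l p_gt0) [p * r0.-1]mulnC; lia.
exists (u :: us); split=> /=; rewrite ?sus //.
- rewrite uus andbT; apply/negP => /(allP hu)/negP; apply.
  by have [] := count_related hh sh st uS.
- by move=> x; rewrite inE => /predU1P[->|/subS].
have symrel x y : related h x y = related h y x.
  by apply: eq_has => w; rewrite andbC.
move=> x y; rewrite !inE => /predU1P[->|xus] /predU1P[->|yus]; rewrite ?eqxx // => xy.
- by rewrite symrel (allP hu).
- exact: (allP hu).
- exact: nrel.
Qed.

Lemma block_exists h u m : history h -> size h + m <= hmax -> u \in saturated ->
  exists e, [/\ size e = m, history (e ++ h) & all (fun v => c u v == 1) e].
Proof.
move=> hh; elim: m => [|m IH] sh uS; first by exists [::].
have [|e [se he ce]] := IH _ uS; first by lia.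
have [|v hv cuv] := history_extend he _ uS; first by rewrite size_cat se; lia.
by exists (v :: e); rewrite /= se cuv ce.
Qed.

Lemma blocks_exist h us m : history h -> size h + size us * m <= hmax ->
  {subset us <= saturated} ->
  exists e, [/\ size e = size us * m, history (e ++ h) &
    {in us, forall u, m <= count (fun v => c u v == 1) e}].
Proof.
move=> hh; elim: us => [|u us IH] sh sub; first by exists [::].
have [||e [se he ce]] := IH; first by move: sh; rewrite /= mulSn; lia.
  by move=> x xus; apply: sub; rewrite inE xus orbT.
have [||b [sb hb cb]] := @block_exists (e ++ h) u m he.
- by rewrite size_cat se; move: sh; rewrite /= mulSn; lia.
- by apply: sub; rewrite mem_head.
exists (b ++ e); split; first by rewrite size_cat sb se.
  by rewrite -catA.
move=> x; rewrite inE count_cat => /predU1P[->|/ce xe]; last first.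
  exact: leq_trans (leq_addl _ _).
by move: cb; rewrite all_count sb => /eqP->; rewrite leq_addr.
Qed.

(** A stable history is extended by [p.+1] vertices at deficit 1 to each of [r0] unrelated labels. A
    vertex at deficit 1 to two labels would relate them, and [history_pair] reads the deficits
    between new vertices off the labels. *)
Lemma classes_exist : exists us cls h, [/\ classes us cls, history h,
  size h <= hmax, {subset us <= saturated} &
  {in us, forall u x, x \in cls u -> x \in h /\ c u x = 1}].
Proof.
have [h [hh sh st]] := stable_exists.
have [us [uus sus subS nrel]] := unrelated_exists hh sh st (leqnn _).
have [|e [se he ce]] := @blocks_exist h us p.+1 hh _ subS.
  by rewrite sus leq_add2r.
have eM : size e <= M by rewrite se sus.
pose cls u := take p.+1 [seq v <- e | c u v == 1].
have clsP u x : x \in cls u -> x \in e /\ c u x = 1.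
  by move=> /mem_take; rewrite mem_filter => /andP[/eqP].
have lab u u' x : u \in us -> u' \in us -> x \in e -> c u x = 1 -> c u' x = 1 -> u = u'.
  move=> uu uu' xe cx cx'; apply/eqP; apply: contraT => /(nrel _ _ uu uu')/negP[].
  by apply: (stable_related st he eM xe) => //; apply: subS.
have lab0 u u' x : u \in us -> u' \in us -> x \in e -> c u x = 1 -> c u' x = (u == u').
  move=> uu uu' xe cx; case: eqP => [<-//|ne].
  have [|xX dx _] := @history_mem _ x he; first by rewrite mem_cat xe.
  have := saturated_le1 (subS _ uu') xX dx.
  have : c u' x <> 1 by move=> cx'; apply: ne; apply: lab cx cx'.
  by lia.
exists us, cls, (e ++ h); split=> //.
- split=> //.
  + move=> u uu; rewrite take_uniq ?size_takel //.
      by rewrite size_filter ce.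
    rewrite filter_uniq //.
    by have := history_uniq he; rewrite cat_uniq => /andP[].
  + by move=> u u' uu uu' x /clsP[xe cx] /clsP[_ cx']; apply: lab cx cx'.
  + move=> u u' uu uu' x y /clsP[xe cx] /clsP[ye cy] xy.
    have [||->|->] := history_pair he _ _ xy (subS _ uu) (subS _ uu') cx cy.
    * by rewrite mem_cat xe.
    * by rewrite mem_cat ye.
    * by rewrite (lab0 u' u) // eq_sym.
    * by rewrite (lab0 u u').
- by rewrite size_cat addnC leq_add.
- by move=> u uu x /clsP[xe ->]; rewrite mem_cat xe.
Qed.

Lemma far_exists us cls h k : classes us cls -> history h -> size h <= hmax ->
  {subset us <= saturated} ->
  {in us, forall u x, x \in cls u -> x \in h /\ c u x = 1} -> k <= rd ->
  exists ws, [/\ uniq ws, size ws = k, {in ws &, forall w w', w != w' -> c w w' = d} &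
    {in ws, forall w, {in us, forall u x, x \in cls u -> x != w /\ c x w = 0}}].
Proof.
move=> cl hh sh subS clsh; elim: k => [|k IH] kr; first by exists [::].
have [ws [uws sws cws zws]] := IH (ltnW kr).
have [uus sus scls _ _] := cl.
pose L u := take p (cls u).
have sL u : u \in us -> [/\ uniq (L u), size (L u) = p & {subset L u <= cls u}].
  move=> /scls[ucls sz]; rewrite take_uniq // size_takel ?sz //; split=> // x.
  exact: mem_take.
have [ufl sfl _] := classes_sub cl sL; set f := flatten _ in ufl sfl.
(* The multiplicities make the allowed total smaller than [p * (k * d).+1]: after division by [p],
   the comparison reduces to [p * k < rd * (k * d).+1], that is, to [k < rd]. *)
pose l := flatten (nseq (k * d).+1 f) ++ flatten (nseq p ws).
have size_nseq_flatten m (t : seq V) : size (flatten (nseq m t)) = m * size t.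
  by elim: m => //= m IHm; rewrite size_cat IHm mulSn.
have deg_nseq_flatten m (t : seq V) v : deg c (flatten (nseq m t)) v = m * deg c t v.
  by elim: m => [|m IHm]; rewrite /= ?deg_cat ?IHm // /deg big_nil.
have sl : size l = (k * d).+1 * (r0 * p) + p * k.
  by rewrite size_cat !size_nseq_flatten sfl sws.
have kdp : (k * d).+1 <= p by rewrite pE ltnS mulnC leq_mul2l ltnW ?orbT.
have [|v [gv vl dl]] := @generic_exists h l hh sh.
  by rewrite sl NE mulnDr leq_add // leq_mul // ltnW.
have [vXh dv gtwin] := gv.
have vX : v \notin X by move: vXh; rewrite mem_cat negb_or => /andP[].
have vh : v \notin h by move: vXh; rewrite mem_cat negb_or => /andP[].
have vws : v \notin ws.
  apply: contra vl => vws; rewrite mem_cat; apply/orP; right.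
  by case: (p) p_gt0 => // q _; rewrite /= mem_cat vws.
have small : (k * d).+1 * deg c f v + p * deg c ws v < p * (k * d).+1.
  rewrite -(ltn_pmul2l N_gt0); move: dl; rewrite deg_cat !deg_nseq_flatten sl.
  move=> /leq_ltn_trans; apply.
  have -> : N * (p * (k * d).+1) = p * ((k * d).+1 * (r0 * p) + rd * (k * d).+1).
    by rewrite NE mulnCA mulnDl [r0 * p * _]mulnC.
  rewrite ltn_pmul2l // ltn_add2l pE mulSn mulnS -mulnA mulnCA [d * k]mulnC.
  by rewrite ltn_add2r.
(* Genericity makes [v] constant on a class, so deficit 1 to one class already costs [p] on [f],
   against [small]. *)
have c0 u : u \in us -> c u v = 0.
  move=> uu; have := saturated_le1 (subS _ uu) vX dv.
  case cuv: (c u v) => [//|[|//]] _; exfalso.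
  have : p <= deg c f v.
    have [uL szL subL] := sL u uu.
    have fE : perm_eq f (L u ++ flatten [seq L x | x <- rem u us]).
      by rewrite (perm_flatten (perm_map L (perm_to_rem uu))).
    rewrite /deg (perm_big _ fE) -/(deg _ _ _) deg_cat -{1}szL -[size _]mul1n.
    apply: leq_trans (leq_addr _ _); apply: deg_ge => x /subL xc.
    by have [xh cux] := clsh _ uu _ xc; rewrite (gtwin x u) ?cuv ?subS.
  rewrite -(leq_pmul2l (ltn0Sn (k * d))) [_ * p]mulnC => le.
  by have := leq_ltn_trans (leq_addr _ _) small; rewrite ltnNge le.
have zv u x : u \in us -> x \in cls u -> x != v /\ c x v = 0.
  move=> uu xc; have [xh cux] := clsh _ uu _ xc.
  by rewrite (gtwin x u) ?subS ?c0 //; split=> //; apply: contraNneq vh => <-.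
have dge w : w \in ws -> d <= c w v.
  move=> wws; apply: (far_pair (L := cls)) cl _ _ _.
  - move=> u uu; have [uc ->] := scls u uu; split=> //.
    by rewrite pE leqW // leqW // leq_pmulr.
  - by move=> u uu x xc; have [? ?] := zv u x uu xc; have [? ?] := zws w wws u uu x xc.
  - by apply: contraNneq vws => ->.
(* [small] bounds the total to [ws] by [k * d], and each of the [k] terms is at least [d]. *)
have deq w : w \in ws -> c w v = d.
  move=> wws; apply/eqP; rewrite eqn_leq dge // andbT.
  have : deg c ws v <= k * d.
    rewrite -ltnS -(ltn_pmul2l p_gt0); apply: leq_ltn_trans small.
    exact: leq_addl.
  rewrite (deg_rem c v wws).
  have : d * size (rem w ws) <= deg c (rem w ws) v.
    by apply: deg_ge => y /mem_rem /dge.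
  rewrite size_rem // sws; case: (k) sws => [|m _]; last first.
    by rewrite mulSn mulnC /= => h1 h2; clear -h1 h2; lia.
  by move=> /size0nil ws0; rewrite ws0 in wws.
exists (v :: ws); rewrite /= vws uws sws; split=> //.
  move=> x y; rewrite !inE => /predU1P[->|xw] /predU1P[->|yw]; rewrite ?eqxx // => xy.
  - by rewrite csym deq.
  - exact: deq.
  - exact: cws.
by move=> w; rewrite inE => /predU1P[->|/zws//] u uu x; apply: zv.
Qed.

End TightSet.

Lemma core_exists : exists A W, [/\ size A = r0 * p.+1, size W = rd,
  {in W, forall w, w \notin A} & forall v, v \notin A -> v \notin W ->
    p < deg c A v + deg c W v \/
    {in W, forall w, d <= c w v} /\ exists2 w, w \in W & d < c w v].
Proof.
have [X tX] := tight_exists.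
have [us [cls [h [cl hh sh subS clsh]]]] := classes_exist tX.
have [ws [uws sws cws zws]] := far_exists tX cl hh sh subS clsh (leqnn rd).
have [uus sus scls _ _] := cl.
exists (flatten [seq cls u | u <- us]), ws; split=> //.
- by have [] := classes_sub cl (fun u uu => let: conj a b := scls u uu in And3 a b (fun x xx => xx)).
- by move=> w wws; apply/flatten_mapP => -[u uu wc]; have [] := zws w wws u uu w wc; rewrite eqxx.
move=> v vA vW.
have vcls u : u \in us -> v \notin cls u.
  by move=> uu; apply: contra vA => vc; apply/flatten_mapP; exists u.
(* From each class the vertex with the largest deficit to [v] is set aside. The rest and [ws] form
   an [N]-set receiving at least [p]. If the rest receives 0, the excess lies on [ws]; otherwise
   some set-aside vertex has positive deficit and pushes the total above [p]. *)
have /choice[t tP] : forall u, exists x, u \in us ->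
    x \in cls u /\ {in cls u, forall y, c y v <= c x v}.
  move=> u; have [uu|nu] := boolP (u \in us); last by exists u.
  have [|x xc xmax] := @seq_argmax _ (c^~ v) (cls u); last by exists x.
  by have [_] := scls u uu; case: (cls u).
pose L u := rem (t u) (cls u).
have sL u : u \in us -> [/\ uniq (L u), size (L u) = p & {subset L u <= cls u}].
  move=> uu; have [ucls sz] := scls u uu; have [tu _] := tP u uu.
  by rewrite rem_uniq // size_rem // sz; split=> // x /mem_rem.
set f := flatten [seq L u | u <- us].
have zf w u x : w \in ws -> u \in us -> x \in L u -> x != w /\ c x w = 0.
  by move=> wws uu xL; apply: (zws w wws u uu); have [_ _] := sL u uu; apply.
have vf : v \notin f.
  by apply/flatten_mapP => -[u uu vL]; have := vcls u uu; have [_ _ ->] := sL u uu.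
have per := period_deg cl sL uws sws cws (fun w wws u uu x => zf w u x wws uu) vf vW.
have [s0|spos] := posnP (deg c f v); [right | left].
  have c0 u x : u \in us -> x \in L u -> x != v /\ c x v = 0.
    move=> uu xL; split.
      by apply: contraTneq (vcls u uu) => <-; rewrite negbK; have [_ _] := sL u uu; apply.
    have xf : x \in f by apply/flatten_mapP; exists u.
    by have := deg_mem c v xf; rewrite s0 leqn0 => /eqP.
  have dge w : w \in ws -> d <= c w v.
    move=> wws; apply: (far_pair (L := L)) cl _ _ _.
    - by move=> u uu; have [? -> ?] := sL u uu; split=> //; rewrite pE leqW // leq_pmulr.
    - by move=> u uu x xL; have [? ?] := c0 u x uu xL; have [? ?] := zf w u x wws uu xL.
    - by apply: contraNneq vW => ->.
  split=> //; apply: contrapT => no; move: per; rewrite s0 add0n leqNgt => /negP; apply.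
  rewrite pE ltnS -sws; apply: leq_sum_const => w wws.
  by rewrite leqNgt; apply/negP => dw; apply: no; exists w.
have [u0 uu0 du0] : exists2 u, u \in us & 0 < c (t u) v.
  apply: contrapT => no; move: spos; rewrite lt0n => /negP; apply.
  rewrite (@deg_const _ _ _ _ 0) // => x /flatten_mapP[u uu xL].
  have [tu tmax] := tP u uu; have [_ _ subL] := sL u uu.
  apply/eqP; rewrite -leqn0 (leq_trans (tmax x (subL x xL))) // leqNgt.
  by apply/negP => ctu; apply: no; exists u.
apply: leq_ltn_trans per _; rewrite ltn_add2r !deg_flatten !big_map.
have -> : \sum_(u <- us) deg c (cls u) v =
    \sum_(u <- us) c (t u) v + \sum_(u <- us) deg c (L u) v.
  rewrite -big_split /= big_seq [RHS]big_seq; apply: eq_bigr => u uu.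
  by have [tu _] := tP u uu; rewrite (deg_rem c v tu).
by rewrite -{1}[\sum_(u <- us) deg c (L u) v]add0n ltn_add2r (big_rem u0) //= addn_gt0 du0.
Qed.

End Core.

(** * The deficit of blow-ups *)

Section BigPairs.
Variables (R : Type) (idx : R) (op : Monoid.com_law idx) (V : finType).
Variable F : {set V} -> R.

Lemma big_pairsU1 (S : {set V}) v : v \notin S ->
  \big[op/idx]_(e : {set V} | (e \subset v |: S) && (#|e| == 2)) F e =
  op (\big[op/idx]_(u in S) F [set u; v])
     (\big[op/idx]_(e : {set V} | (e \subset S) && (#|e| == 2)) F e).
Proof.
move=> vS; rewrite (bigID (fun e : {set V} => v \in e)) /=; congr (op _ _).
- rewrite -(big_imset (h := fun u => [set u; v])) /=; last first.
    move=> x y xS yS /setP/(_ x); rewrite !inE eqxx /= => /esym/orP[/eqP//|/eqP xv].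
    by move: vS; rewrite -xv xS.
  apply: eq_bigl => e; apply/andP/imsetP.
    move=> [/andP[sub /cards2P[x [y [xy eE]]]] ve]; move: ve; subst e.
    rewrite !inE => /orP[]/eqP vE; subst v.
      exists y; last by rewrite finset.setUC.
      have := fintype.subsetP sub y; rewrite !inE eqxx orbT => /(_ isT)/orP[/eqP yv|//].
      by rewrite yv eqxx in xy.
    exists x => //; have := fintype.subsetP sub x; rewrite !inE eqxx => /(_ isT)/orP[/eqP yv|//].
    by rewrite yv eqxx in xy.
  move=> [u uS ->]; rewrite !inE eqxx orbT cards2.
  have -> : u != v by apply: contraNneq vS => <-.
  by rewrite andbT; split=> //; apply/fintype.subsetP => x; rewrite !inE => /orP[]/eqP->;
    rewrite ?uS ?eqxx ?orbT.
apply: eq_bigl => e; rewrite -andbA [_ && (v \notin e)]andbC andbA; congr (_ && _).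
apply/andP/idP => [[/fintype.subsetP sub ve]|/fintype.subsetP sub].
  apply/fintype.subsetP => x xe; have := sub x xe; rewrite !inE => /orP[/eqP xv|//].
  by rewrite xv in xe; rewrite xe in ve.
split; first by apply/fintype.subsetP => x /sub xS; rewrite inE xS orbT.
by apply: contra vS => /sub.
Qed.

Lemma big_pairs0 :
  \big[op/idx]_(e : {set V} | (e \subset finset.set0) && (#|e| == 2)) F e = idx.
Proof.
by apply: big_pred0 => e; rewrite finset.subset0; apply/andP => -[/eqP->]; rewrite cards0.
Qed.

End BigPairs.

Lemma edge_sum_in_seq (V : finType) (G : multigraph V) (l : seq V) : uniq l ->
  edge_sum_in G [set x in l] = psum (fun u v => G [set u; v]) l.
Proof.
elim: l => [|v l IH] /= => [_|/andP[vl ul]].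
  have -> : [set x in Nil V] = finset.set0 by apply/setP => x; rewrite !inE.
  by rewrite /edge_sum_in big_pairs0.
have -> : [set x in v :: l] = v |: [set x in l] by apply/setP => x; rewrite !inE.
rewrite -IH // /edge_sum_in big_pairsU1 ?inE //; congr (_ + _).
by rewrite /deg (big_uniq _ ul); apply: eq_bigl => u; rewrite inE.
Qed.

Lemma edge_sum_in_enum (V : finType) (G : multigraph V) (S : {set V}) :
  edge_sum_in G S = psum (fun u v => G [set u; v]) (enum S).
Proof.
rewrite -edge_sum_in_seq ?enum_uniq //; congr edge_sum_in.
by apply/setP => x; rewrite inE mem_enum.
Qed.

Section Defect.
Variables (r0 rd d : nat) (T : finType) (b : pred T).
Hypotheses (r0_gt0 : 0 < r0) (rd_gt0 : 0 < rd) (d_gt0 : 0 < d).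
Hypotheses (cb : #|b| = r0) (cbC : #|predC b| = rd).
Notation p := (d * rd).+1.
Notation N := (r0 * p + rd).

(** With [b] marking the first block, this is [a + 1] minus the multiplicity in the Turan pattern;
    see [turan_two_blocks]. *)
Definition defect (i j : T) : nat := (i == j) + d * (~~ b i && ~~ b j).

Lemma defectC i j : defect i j = defect j i.
Proof. by rewrite /defect eq_sym andbC. Qed.

Variables (V : eqType) (f : V -> T).
Notation c := (fun u v => defect (f u) (f v)).

Lemma deg_defect l v : deg c l v = count (fun u => f u == f v) l +
  d * (~~ b (f v)) * count (fun u => ~~ b (f u)) l.
Proof.
elim: l => [|x l IH]; first by rewrite /deg big_nil /= muln0.
rewrite deg_cons IH /= /defect; case: (b (f x)); case: (b (f v)); lia.
Qed.

Lemma count_fibers (P : pred T) l :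
  count (fun u => P (f u)) l = \sum_(i | P i) count (fun u => f u == i) l.
Proof.
elim: l => [|x l IH] /=; first by rewrite big1.
rewrite IH big_split /=; congr (_ + _).
case: (boolP (P (f x))) => Px.
  rewrite (bigD1 (f x)) //= eqxx big1 ?addn0 // => i /andP[_ ne].
  by rewrite eq_sym (negPf ne).
by rewrite big1 // => i Pi; case: eqP => // E; rewrite E Pi in Px.
Qed.

(** A top type with more than [m] vertices provides [v]. If there is none, few vertices are top, so
    many are low, and a vertex of the commonest low type works. *)
Lemma defect_large_deg l : 0 < size l ->
  exists2 v, v \in l & (p * (size l).-1) %/ N <= deg c (rem v l) v.
Proof.
move=> l0; set m := _ %/ _.
have mN : m * N <= p * (size l).-1 by apply: leq_divM.
pose x i := count (fun u => f u == i) l.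
have xin i : 0 < x i -> exists2 v, v \in l & f v = i.
  by rewrite -has_count => /hasP[v vl /eqP fv]; exists v.
have drem v : v \in l -> (1 + d * ~~ b (f v)) + deg c (rem v l) v =
    x (f v) + d * (~~ b (f v)) * count (fun u => ~~ b (f u)) l.
  by move=> vl; rewrite -deg_defect (deg_rem c v vl) /defect eqxx andbb.
have [/existsP[i /andP[bi mi]]|nb] := boolP [exists i, b i && (m < x i)].
  have [|v vl fv] := xin i; first exact: leq_ltn_trans mi.
  exists v => //; have := drem v vl.
  by rewrite fv bi /= !muln0 mul0n; clear -mi; lia.
have cntb : count (fun u => b (f u)) l <= m * r0.
  rewrite (count_fibers b) -cb mulnC -sum_nat_const; apply: leq_sum => i bi.
  by move: nb => /existsPn/(_ i); rewrite [b i]bi /= -leqNgt.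
set u := count (fun u => ~~ b (f u)) l.
have tot : count (fun u => b (f u)) l + u = size l by apply: count_predC.
(* Combine [m * N <= p * (size l).-1] with [size l <= m * r0 + u]. *)
have pu : rd * m + p <= p * u by nia.
have u0 : 0 < u by case: (u) pu => //; rewrite muln0; lia.
have [i bi ui] : exists2 i, ~~ b i & u <= rd * x i.
  apply: contrapT => no.
  have : rd * u <= rd * u.-1.
    rewrite {1}/u (count_fibers (predC b)) big_distrr /= -{2}cbC -sum_nat_const.
    apply: leq_sum => i bi; rewrite -ltnS prednK // ltnNge; apply/negP => h.
    by apply: no; exists i.
  by rewrite leq_pmul2l //; case: (u) u0 => // w _; rewrite ltnn.
have [|v vl fv] := xin i; first by case: (x i) ui => //; rewrite muln0; lia.
exists v => //; have := drem v vl.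
rewrite fv bi /= -/u.
have : rd * m < rd * (d * u.-1 + x i).
  move: (x i) pu ui u0 => y; clearbody u m; clear; case: u => //= w; lia.
rewrite ltn_pmul2l //.
case: (u) u0 => // w _ /=; rewrite mulnS; lia.
Qed.

Lemma incr_sum_le_defect l : incr_sum p N (size l) <= psum c l.
Proof.
have [n] := ubnP (size l); elim: n l => // n IH l ln.
have [/size0nil->|l0] := posnP (size l); first by rewrite /incr_sum big_geq.
have [v vl dv] := defect_large_deg l0.
have csym u w : c u w = c w u by apply: defectC.
rewrite (psum_rem csym vl) -(prednK l0) incr_sumS addnC leq_add //.
by rewrite -(size_rem vl) IH // size_rem //; lia.
Qed.

End Defect.

(** * The Turan pattern with two nonempty blocks *)

Section TuranTwoBlocks.
Variables (r0 rd d a : nat).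
Hypotheses (r0_gt0 : 0 < r0) (rd_gt0 : 0 < rd) (d_gt0 : 0 < d) (da : d <= a).
Notation r := (r0 :: rcons (nseq d.-1 0) rd).
Notation p := (d * rd).+1.
Notation N := (r0 * p + rd).

Lemma sumn_two_blocks : sumn r = r0 + rd.
Proof. by rewrite /= sumn_rcons sumn_nseq mul0n. Qed.

Definition top_block (i : 'I_(sumn r)) : bool := i < r0.

Lemma card_top_block : #|top_block| = r0.
Proof.
rewrite -sum1_card (eq_bigl (fun i : 'I_(sumn r) => i < r0)) //.
rewrite big_ord_narrow; first by rewrite sumn_two_blocks leq_addr.
by rewrite sum1_card card_ord.
Qed.

Lemma card_low_block : #|predC top_block| = rd.
Proof.
apply: (@addnI r0); rewrite -{1}card_top_block cardC card_ord.
exact: sumn_two_blocks.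
Qed.

Lemma turan_block_top i : top_block i -> turan_block i = 0.
Proof. by move=> it; apply/turan_blockP => //=; rewrite take0 /= addn0. Qed.

Lemma turan_block_low i : ~~ top_block i -> turan_block i = d.
Proof.
move=> it; apply/turan_blockP; first by rewrite /= size_rcons size_nseq prednK.
have sr : size r = d.+1 by rewrite /= size_rcons size_nseq prednK.
rewrite -sr take_size ltn_ord andbT.
have -> : take d r = r0 :: nseq d.-1 0.
  rewrite -{1}(prednK d_gt0) /= -cats1 take_cat size_nseq ltnn subnn take0 cats0.
  by [].
by rewrite /= sumn_nseq mul0n addn0 leqNgt.
Qed.

Lemma turan_two_blocks i j :
  turan_pattern r a [set i; j] + defect d top_block i j = a.+1.
Proof.
wlog ij : i j / i <= j.
  by move=> H; case/orP: (leq_total i j) => /H //; rewrite finset.setUC defectC.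
have [/val_inj ->|ne] := eqVneq (val i) (val j).
  rewrite finset.setUid turan_loop /defect eqxx andbb.
  case: (boolP (top_block j)) => tj; rewrite ?(turan_block_top tj) ?(turan_block_low tj) /=; lia.
have lt : i < j by rewrite ltn_neqAle ne.
have nij : i != j by apply: contra ne => /eqP->.
rewrite turan_pair // /defect (negPf nij).
case: (boolP (top_block i)) => ti; rewrite ?(turan_block_top ti) ?(turan_block_low ti) /=; first lia.
have -> : ~~ top_block j by move: ti; rewrite /top_block; lia.
by rewrite /=; lia.
Qed.

Lemma psum_turan (V : eqType) (f : V -> 'I_(sumn r)) l :
  psum (fun u v => turan_pattern r a [set f u; f v]) l +
  psum (fun u v => defect d top_block (f u) (f v)) l = a.+1 * 'C(size l, 2).
Proof.
elim: l => [|x l IH] //=; first by rewrite muln0.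
rewrite binS bin1 mulnDr -IH addnACA addnC; congr (_ + _).
rewrite -big_split /= (eq_bigr (fun=> a.+1)); last by move=> u _; apply: turan_two_blocks.
by rewrite big_const_seq count_predT iter_addn_0.
Qed.

Lemma Sigma_turan s :
  Sigma_pat (turan_pattern r a) s + incr_sum p N s <= a.+1 * 'C(s, 2).
Proof.
have R0 : 0 < sumn r by rewrite sumn_two_blocks addn_gt0 r0_gt0.
rewrite /Sigma_pat; have [|f ->] := eq_bigmax (fun f : {ffun 'I_s -> 'I_(sumn r)} =>
    edge_sum (blowup (turan_pattern r a) f)).
  by apply/card_gt0P; exists [ffun=> Ordinal R0].
have se : size (enum [set: 'I_s]) = s by rewrite -cardE cardsT card_ord.
rewrite /edge_sum edge_sum_in_enum -[X in 'C(X, 2)]se -(psum_turan f).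
have -> : psum (fun u v => blowup (turan_pattern r a) f [set u; v]) =
    psum (fun u v => turan_pattern r a [set f u; f v]).
  by congr psum; apply/funext => u; apply/funext => v; apply: blowupE.
rewrite leq_add2l -{1}se.
by apply: incr_sum_le_defect; rewrite ?card_top_block ?card_low_block.
Qed.

End TuranTwoBlocks.

Import Order.TTheory GRing.Theory Num.Theory.
Local Open Scope ring_scope.

(** * The logarithmic density *)

Section LogDefect.
Variables (R : realType) (a : nat).

(** The logarithmic loss of a pair of deficit [c]. *)
Definition ell (c : nat) : R := ln a.+1%:R - ln (a.+1 - c)%:R.

Lemma ln_le_subr1 (x : R) : 0 < x -> ln x <= x - 1.
Proof. by move=> x0; have := @le_ln1Dx R (x - 1); rewrite addrCA subrr addr0; apply; lra. Qed.

Lemma ln_sub_ge (x y : R) : 0 < x -> 0 < y -> (x - y) / x <= ln x - ln y.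
Proof.
move=> x0 y0; have := @ln_le_subr1 (y / x) (divr_gt0 y0 x0).
rewrite ln_div ?posrE // mulrBl divff ?gt_eqF //; lra.
Qed.

Lemma ell0 : ell 0 = 0.
Proof. by rewrite /ell subn0 subrr. Qed.

Lemma ell_ge c : (c <= a)%N -> c%:R / a.+1%:R <= ell c.
Proof.
move=> ca; have := @ln_sub_ge a.+1%:R (a.+1 - c)%:R.
rewrite !ltr0n subn_gt0 [(c < _)%N]ca => /(_ isT isT).
have -> // : a.+1%:R - (a.+1 - c)%:R = c%:R :> R.
by rewrite natrB ?leqW // opprB addrC subrK.
Qed.

Lemma ell_le c : (c <= a)%N -> ell c <= c%:R / (a.+1 - c)%:R.
Proof.
move=> ca; have := @ln_sub_ge (a.+1 - c)%:R a.+1%:R.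
rewrite !ltr0n subn_gt0 [(c < _)%N]ca => /(_ isT isT).
have -> : (a.+1 - c)%:R - a.+1%:R = - c%:R :> R by rewrite natrB ?leqW //; lra.
by rewrite mulNr /ell; lra.
Qed.

Lemma ell_mono c c' : (c <= c' <= a)%N -> ell c <= ell c'.
Proof.
move=> /andP[cc' c'a]; rewrite lerD2l lerN2 ler_ln ?posrE ?ltr0n ?subn_gt0 ?ltnS //.
  by rewrite ler_nat leq_sub2l.
exact: leq_trans cc' c'a.
Qed.

(** Concavity of the logarithm: every increment of [ell] is at least the first one. *)
Lemma ell_superlinear c : (c <= a)%N -> c%:R * ell 1 <= ell c.
Proof.
elim: c => [|c IH] ca; first by rewrite mul0r ell0.
have {}IH := IH (ltnW ca).
suff : ell 1 <= ell c.+1 - ell c by rewrite -natr1 mulrDl mul1r; lra.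
have pos n : (n <= a)%N -> (0 : R) < (a.+1 - n)%:R by rewrite ltr0n subn_gt0 ltnS.
rewrite /ell.
suff : ln (a.+1 - c.+1)%:R + ln a.+1%:R <= ln (a.+1 - c)%:R + ln (a.+1 - 1)%:R :> R by lra.
rewrite -!lnM ?posrE ?pos ?ltr0n // ?(ltnW ca) ?(leq_trans _ ca) //.
rewrite ler_ln ?posrE ?mulr_gt0 ?pos ?ltr0n // ?(ltnW ca) ?(leq_trans _ ca) //.
by rewrite -!natrM ler_nat; nia.
Qed.

End LogDefect.

Section Rate.
Variables (R : realType) (r0 rd d a : nat).
Hypotheses (r0_gt0 : (0 < r0)%N) (rd_gt0 : (0 < rd)%N) (d_gt0 : (0 < d)%N).
Notation p := (d * rd).+1.
Notation N := (r0 * p + rd)%N.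

(** The optimal weights: [top_weight] is what a low vertex loses to the low block at unit weights,
    [low_weight] what a top vertex loses to its own type. Giving each block the loss of the other
    makes every vertex of the pattern lose [al * ga]. *)
Definition top_weight : R := rd.-1%:R * ell R a d + ell R a d.+1.
Definition low_weight : R := ell R a 1.
Notation ga := top_weight.
Notation al := low_weight.

Definition loss : R := al * ga / (r0%:R * ga + rd%:R * al).
Definition rate : R := ln a.+1%:R - loss.

Hypothesis da : (d < a)%N.

Lemma low_weight_gt0 : 0 < al.
Proof.
apply: lt_le_trans (ell_ge R (leq_ltn_trans (leq0n d) da)).
by rewrite divr_gt0.
Qed.

Lemma top_weight_gt0 : 0 < ga.
Proof.
apply: ltr_wpDl; last first.
  by apply: lt_le_trans (ell_ge R da); rewrite divr_gt0.
by rewrite mulr_ge0 // (le_trans _ (ell_ge R (ltnW da))) // divr_ge0.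
Qed.

Lemma weight_gt0 : 0 < r0%:R * ga + rd%:R * al.
Proof. by rewrite addr_gt0 // mulr_gt0 ?low_weight_gt0 ?top_weight_gt0 ?ltr0n. Qed.

Lemma lossE : loss * (r0%:R * ga + rd%:R * al) = al * ga.
Proof. by rewrite divfK // gt_eqF ?weight_gt0. Qed.

Lemma low_weight_le : al * (a - d)%:R <= 1.
Proof.
have a0 : (0 < a)%N by apply: leq_ltn_trans da.
have := ell_le R a0; rewrite -/al subSS subn0 => H.
apply: le_trans (_ : 1%:R / a%:R * a%:R <= _); last by rewrite divfK // pnatr_eq0; lia.
by rewrite ler_pM ?ler_nat ?leq_subr // ltW ?low_weight_gt0.
Qed.

Lemma top_weight_le : ga * (a - d)%:R <= p%:R.
Proof.
have D0 : (0 : R) < (a - d)%:R by rewrite ltr0n subn_gt0.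
have h1 : ell R a d * (a - d)%:R <= d%:R.
  apply: le_trans (ler_wpM2r (ltW D0) (ell_le R (ltnW da))) _.
  rewrite mulrAC ler_pdivrMr; last by rewrite ltr0n subn_gt0 ltnS ltnW.
  by rewrite ler_wpM2l // ler_nat leq_sub2r.
have h2 : ell R a d.+1 * (a - d)%:R <= d.+1%:R.
  apply: le_trans (ler_wpM2r (ltW D0) (ell_le R da)) _.
  by rewrite subSS divfK // gt_eqF.
rewrite /top_weight mulrDl -mulrA.
apply: le_trans (lerD (ler_wpM2l (ler0n _ _) h1) h2) _.
by rewrite -natrM -natrD ler_nat; clear -rd_gt0; nia.
Qed.

Lemma loss_gt0 : 0 < loss.
Proof. by rewrite divr_gt0 ?mulr_gt0 ?weight_gt0 ?low_weight_gt0 ?top_weight_gt0. Qed.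

Lemma loss_le_low : loss <= al.
Proof.
rewrite ler_pdivrMr ?weight_gt0 // ler_wpM2l ?(ltW low_weight_gt0) //.
apply: ler_wpDr; first by rewrite mulr_ge0 // ltW ?low_weight_gt0.
by rewrite ler_peMl ?ler1n // ltW ?top_weight_gt0.
Qed.

Lemma loss_le : N%:R * (a - d)%:R * loss <= p%:R.
Proof.
rewrite mulrA ler_pdivrMr ?weight_gt0 //.
have h1 := low_weight_le; have h2 := top_weight_le.
have a0 := low_weight_gt0; have g0 := top_weight_gt0.
move: h1 h2; set D := (a - d)%:R => h1 h2.
rewrite natrD natrM.
have e1 : r0%:R * p%:R * ga * (al * D) <= r0%:R * p%:R * ga * 1.
  by rewrite ler_wpM2l // !mulr_ge0 // ltW.
have e2 : rd%:R * al * (ga * D) <= rd%:R * al * p%:R.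
  by rewrite ler_wpM2l // !mulr_ge0 // ltW.
lra.
Qed.

(** The slack of [1 / m] per vertex is at most 1 in total on lists of length at most [m], so
    integrality will absorb it. *)
Lemma loss_le_approx m : (p * d.+1 * m <= a - d)%N -> (0 < m)%N ->
  N%:R * a.+1%:R * loss <= p%:R + m%:R^-1.
Proof.
move=> mD m0; have D0 : (0 : R) < (a - d)%:R by rewrite ltr0n subn_gt0.
have aE : a.+1%:R = (a - d)%:R + d.+1%:R :> R by rewrite -natrD; congr (_%:R); lia.
have L := loss_le; have l0 := loss_gt0.
have L2 : N%:R * loss <= p%:R / (a - d)%:R.
  by rewrite ler_pdivlMr // mulrAC.
rewrite aE mulrDr mulrDl lerD // mulrAC.
apply: le_trans (ler_wpM2r (ler0n _ _) L2) _.
rewrite mulrAC ler_pdivrMr // ler_pdivlMl ?ltr0n //.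
by rewrite -!natrM ler_nat; lia.
Qed.

Lemma rate_gt0 : (1 < a)%N -> 0 < rate.
Proof.
move=> a1; have := loss_le_low; rewrite /rate /low_weight /ell subSS subn0.
have : 0 < ln a%:R :> R by rewrite ln_gt0 // ltr1n.
lra.
Qed.

Lemma top_weight_le_low : (p + d * p.+1 <= a)%N -> ga <= p.+1%:R * al.
Proof.
move=> ha; have D0 : (0 : R) < (a - d)%:R by rewrite ltr0n subn_gt0.
have a1 : (1 <= a)%N by apply: leq_trans da.
have h1 : 1 / a.+1%:R <= al by exact: (ell_ge R a1).
have h2 := top_weight_le; rewrite -ler_pdivlMr // in h2.
apply: le_trans h2 _; apply: le_trans (ler_wpM2l (ler0n _ _) h1).
rewrite mulrA mulr1 ler_pdivrMr // mulrAC ler_pdivlMr ?ltr0n //.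
by rewrite -!natrM ler_nat; clear -ha da rd_gt0 d_gt0; nia.
Qed.

End Rate.

(** * No large logarithmic degrees *)

Section Sparse.
Variables (R : realType) (r0 rd d s a : nat).
Hypotheses (r0_gt0 : (0 < r0)%N) (rd_gt0 : (0 < rd)%N) (d_gt0 : (0 < d)%N).
Variables (p N m : nat).
Hypotheses (pE : p = (d * rd).+1) (NE : N = (r0 * p + rd)%N).
Hypothesis sN : (N < s)%N.
Notation M := (r0 * p.+1)%N.
Notation B := ((p * (p * N)).+1 * (N * ((M * (N * N) + M) * N).+1) + p * N)%N.
Hypotheses (sm : (s <= m)%N) (Bm : (B <= m)%N) (Mm : (M + rd <= m)%N).
Hypotheses (am : (p * d.+1 * m <= a - d)%N) (da : (d < a)%N)
  (ap : (p + d * p.+1 <= a)%N).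
Variables (V : eqType) (w : V -> V -> nat) (x0 : V).
Hypothesis wC : forall u v, w u v = w v u.
Hypothesis w_gt0 : forall u v, u != v -> (0 < w u v)%N.
Hypothesis w_sq : forall l, uniq l -> size l = s ->
  (psum w l + incr_sum p N s <= a.+1 * 'C(s, 2))%N.
Notation lam := (rate R r0 rd d a).
Hypothesis large_deg : forall (l : seq V) (y : V -> R), (0 < size l <= m)%N ->
  {in l, forall u, 0 < y u} -> exists2 v, v \notin l &
    lam * (\sum_(u <- l) y u) < \sum_(u <- l) y u * ln (w u v)%:R.

Let m_gt0 : (0 < m)%N. Proof. exact: leq_trans (leq_ltn_trans (leq0n _) sN) sm. Qed.
Let N_gt0 : (0 < N)%N. Proof. by rewrite NE addn_gt0 rd_gt0 orbT. Qed.

(** For unit weights, [ln x <= x - 1] turns the logarithmic degree into a total deficit: [N] times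
    it lies strictly below [p * size l + 1], and both sides are integers. *)
Lemma low_deficit (l : seq V) : (0 < size l <= m)%N -> exists2 v, v \notin l &
  (N * (a.+1 * size l) <= N * deg w l v + p * size l)%N.
Proof.
move=> lm; have [|v vl H] := @large_deg l (fun=> 1) lm; first by move=> u _; lra.
exists v => //; move: H.
under [X in _ < X -> _]eq_bigr do rewrite mul1r.
rewrite big_const_seq count_predT iter_addr_0 /rate => H.
have e1 : a.+1%:R * (size l)%:R - (deg w l v)%:R <=
    a.+1%:R * (ln a.+1%:R * (size l)%:R - \sum_(u <- l) ln (w u v)%:R) :> R.
  elim: (l) vl => [|u t IH]; first by rewrite /deg !big_nil !mulr0 !subr0 mulr0.
  rewrite inE negb_or => /andP[vu /IH {}IH].
  rewrite deg_cons big_cons natrD /= -[(size t).+1%:R]natr1.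
  have wu : (0 < w u v)%N by rewrite w_gt0 // eq_sym.
  have := @ln_sub_ge R a.+1%:R (w u v)%:R (ltr0Sn _ _) _; rewrite ltr0n => /(_ wu).
  rewrite ler_pdivrMr ?ltr0Sn // => H2; lra.
have e2 := loss_le_approx R r0_gt0 rd_gt0 d_gt0 da.
rewrite -pE -NE in e2; have {}e2 := e2 m am m_gt0.
have l0 : 0 < (size l)%:R :> R by rewrite ltr0n; case/andP: lm.
have lm1 : (m%:R^-1 : R) * (size l)%:R <= 1.
  by rewrite mulrC ler_pdivrMr ?ltr0n // mul1r ler_nat; case/andP: lm.
rewrite -ltnS -(ltr_nat R) -[(_ + _).+1]addn1 !natrD !natrM.
have N0 : 0 < N%:R :> R by rewrite ltr0n.
have a0 : 0 < a.+1%:R :> R by rewrite ltr0Sn.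
have e3 := ler_wpM2l (ltW N0) e1.
have e4 := ler_wpM2r (ltW l0) e2.
rewrite -(ltr_pM2l (mulr_gt0 N0 a0)) in H.
move: e3 e4 H lm1; move: (loss _ _ _ _ _) (\sum_(u <- l) _) (ln _) => x y z.
move: (m%:R^-1) (N%:R) (size l)%:R (p%:R) (a.+1%:R) (deg w l v)%:R => i n t q b e.
lra.
Qed.

(** Reverse induction from [s]: vertices of low deficit extend [l] to size [s] while using at most
    the increments of [E], so a list violating the bound would grow into an [s]-set violating it. *)
Lemma psum_sparse l : uniq l -> (size l <= s)%N ->
  (psum w l + incr_sum p N (size l) <= a.+1 * 'C(size l, 2))%N.
Proof.
move=> ul ls; have [k] := ubnP (s - size l).
elim: k l ul ls => // k IH l ul ls lk.
have [sl|sl] := eqVneq (size l) s; first by rewrite sl w_sq.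
have {}ls : (size l < s)%N by rewrite ltn_neqAle sl.
have [/size0nil->|l0] := posnP (size l); first by rewrite /incr_sum big_geq.
have [|v vl dv] := @low_deficit l; first by rewrite l0 (leq_trans (ltnW ls)).
have := IH (v :: l); rewrite /= vl ul => /(_ isT ls) H.
have : (deg w l v + psum w l + (incr_sum p N (size l) + p * size l %/ N) <=
    a.+1 * ('C(size l, 2) + size l))%N.
  by move: H; rewrite incr_sumS binS bin1; apply; lia.
have := ltn_ceil (p * size l) N_gt0.
rewrite mulnDr; set q := (_ %/ _)%N => cl H2.
rewrite leqNgt; apply/negP => lt.
have : (N * (deg w l v + q.+1) <= N * (a.+1 * size l))%N.
  by rewrite leq_mul2l; apply/orP; right; clear -lt H2; lia.
rewrite mulnDr [(N * q.+1)%N]mulnC => /leq_trans/(_ dv); rewrite leq_add2l leqNgt.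
by rewrite cl.
Qed.

Lemma w_le u v : u != v -> (w u v <= a.+1)%N.
Proof.
move=> uv; have := @psum_sparse [:: v; u]; rewrite /= inE eq_sym uv /=.
rewrite /deg big_nil big_cons big_nil !addn0 muln1 => /(_ isT) H.
apply: leq_trans (leq_addr _ _) (H _).
by apply: leq_trans sN; rewrite ltnS N_gt0.
Qed.

(** The truncated subtraction is exact for distinct vertices, by [w_le]. *)
Definition deficit u v := (a.+1 - w u v)%N.

Lemma deficitC u v : deficit u v = deficit v u.
Proof. by rewrite /deficit wC. Qed.

Lemma deg_deficit l v : v \notin l ->
  (deg deficit l v + deg w l v = a.+1 * size l)%N.
Proof.
elim: l => [|u l IH]; first by rewrite /deg !big_nil muln0.
rewrite inE negb_or => /andP[vu /IH {}IH]; rewrite !deg_cons mulnS -IH.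
rewrite addnACA; congr (_ + _)%N; rewrite /deficit subnK // w_le //.
by rewrite eq_sym.
Qed.

Lemma psum_deficit l : uniq l -> (psum deficit l + psum w l = a.+1 * 'C(size l, 2))%N.
Proof.
elim: l => [|v l IH] /= => [_|/andP[vl /IH {}IH]]; first by rewrite muln0.
by rewrite binS bin1 mulnDr -IH addnACA deg_deficit // addnC.
Qed.

Lemma deficit_core : exists A W, [/\ size A = M, size W = rd,
  {in W, forall x, x \notin A} & forall v, v \notin A -> v \notin W ->
    (p < deg deficit A v + deg deficit W v)%N \/
    {in W, forall x, (d <= deficit x v)%N} /\ exists2 x, x \in W & (d < deficit x v)%N].
Proof.
apply: (core_exists x0 deficitC r0_gt0 rd_gt0 d_gt0 pE NE).
  move=> l ul lN; have := psum_deficit ul; have := psum_sparse ul.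
  by move=> /(_ (leq_trans lN sN)); lia.
move=> l /andP[l0 lB]; have [|v vl dv] := @low_deficit l.
  by rewrite l0 (leq_trans lB).
exists v => //; move: dv; rewrite -(deg_deficit vl) mulnDr; lia.
Qed.

Lemma no_large_deg : False.
Proof.
have [A [W [sA sW WA core]]] := deficit_core.
(* Since [A] has [r0 * p.+1] vertices and [W] only [rd], the factor [p.+1] on [W] restores the
   optimal proportions. It remains to show that every [v] loses at least [p.+1 * al * ga]. *)
pose y u := if u \in W then p.+1%:R * low_weight R a else top_weight R rd d a.
have al0 : 0 < low_weight R a by apply: low_weight_gt0 da.
have ga0 : 0 < top_weight R rd d a by apply: top_weight_gt0.
have [||v vAW] := @large_deg (A ++ W) y.
- by rewrite size_cat sA sW Mm addn_gt0 rd_gt0 orbT.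
- by move=> u _; rewrite /y; case: ifP => // _; rewrite mulr_gt0.
have [vA vW] : v \notin A /\ v \notin W.
  by move: vAW; rewrite mem_cat negb_or => /andP[].
have yA u : u \in A -> y u = top_weight R rd d a.
  by move=> uA; rewrite /y; case: ifP => // /WA; rewrite uA.
have yW u : u \in W -> y u = p.+1%:R * low_weight R a by rewrite /y => ->.
have lnE u : u != v -> ln (w u v)%:R = ln a.+1%:R - ell R a (deficit u v).
  by move=> uv; rewrite /ell opprB addrC subrK /deficit subKn // w_le.
have defa u : u != v -> (deficit u v <= a)%N.
  by move=> uv; rewrite /deficit; have := w_gt0 uv; lia.
have -> : \sum_(u <- A ++ W) y u * ln (w u v)%:R = ln a.+1%:R * \sum_(u <- A ++ W) y u -
    \sum_(u <- A ++ W) y u * ell R a (deficit u v).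
  rewrite mulr_sumr -sumrB; apply: eq_big_seq => u uAW.
  by rewrite lnE; [ring | apply: contraNneq vAW => <-].
have Y : \sum_(u <- A ++ W) y u =
    p.+1%:R * (r0%:R * top_weight R rd d a + rd%:R * low_weight R a).
  rewrite big_cat /= (eq_big_seq _ yA) (eq_big_seq _ yW).
  rewrite !big_const_seq !count_predT !iter_addr_0 sA sW.
  rewrite -(mulr_natl (top_weight R rd d a)) -(mulr_natl (p.+1%:R * _)) natrM.
  ring.
rewrite /rate mulrBl ltrD2l ltrN2 Y mulrCA lossE //.
rewrite big_cat /=.
have -> : \sum_(u <- A) y u * ell R a (deficit u v) =
    top_weight R rd d a * \sum_(u <- A) ell R a (deficit u v).
  by rewrite mulr_sumr; apply: eq_big_seq => u /yA ->.
have -> : \sum_(u <- W) y u * ell R a (deficit u v) =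
    p.+1%:R * low_weight R a * \sum_(u <- W) ell R a (deficit u v).
  by rewrite mulr_sumr; apply: eq_big_seq => u /yW ->.
have lin l : v \notin l ->
    (deg deficit l v)%:R * low_weight R a <= \sum_(u <- l) ell R a (deficit u v).
  elim: l => [|u l IH]; first by rewrite /deg !big_nil mul0r.
  rewrite inE negb_or => /andP[vu /IH {}IH]; rewrite deg_cons big_cons natrD mulrDl.
  by rewrite lerD // ell_superlinear // defa // eq_sym.
have gale : top_weight R rd d a <= p.+1%:R * low_weight R a.
  by rewrite pE; apply: top_weight_le_low; rewrite // -pE.
have key : top_weight R rd d a * low_weight R a * p.+1%:R <=
    top_weight R rd d a * \sum_(u <- A) ell R a (deficit u v) +
    p.+1%:R * low_weight R a * \sum_(u <- W) ell R a (deficit u v); last by lra.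
(* In the first case each of at least [p.+1] units of deficit costs [ga * al] or more. In the second
   the losses to [W] alone add up to at least [ga]. *)
have [Hd|[Wd [x xW xd]]] := core v vA vW.
  have h1 := ler_wpM2l (ltW ga0) (lin A vA).
  have pal0 : 0 <= p.+1%:R * low_weight R a by rewrite mulr_ge0 // ltW.
  have h2 := ler_wpM2l pal0 (lin W vW).
  apply: le_trans (lerD h1 h2).
  have dw0 : 0 <= (deg deficit W v)%:R * low_weight R a by rewrite mulr_ge0 // ltW.
  have h3 := ler_wpM2r dw0 gale.
  have h4 : p.+1%:R <= (deg deficit A v)%:R + (deg deficit W v)%:R :> R.
    by rewrite -natrD ler_nat.
  have h5 := ler_wpM2l (ltW (mulr_gt0 ga0 al0)) h4.
  by apply: le_trans h5 _; rewrite mulrDr; apply: lerD; lra.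
have SW : top_weight R rd d a <= \sum_(u <- W) ell R a (deficit u v).
  have ne u : u \in W -> u != v by move=> uW; apply: contraNneq vW => <-.
  rewrite (big_rem x) //= /top_weight [leLHS]addrC lerD //.
    by rewrite ell_mono // xd defa // ne.
  rewrite -sW -(size_rem xW).
  have : {subset rem x W <= W} by move=> u /mem_rem.
  elim: (rem x W) => [|u l IH] sub; first by rewrite mul0r big_nil.
  rewrite big_cons /= -natr1 mulrDl mul1r [leRHS]addrC lerD //.
    by apply: IH => z zl; apply: sub; rewrite inE zl orbT.
  by rewrite ell_mono // Wd ?defa ?ne ?sub ?mem_head.
have SA : 0 <= \sum_(u <- A) ell R a (deficit u v).
  by apply: le_trans (lin A vA); rewrite mulr_ge0 // ltW.
have pal0 : 0 <= p.+1%:R * low_weight R a by rewrite mulr_ge0 // ltW.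
have h1 := ler_wpM2l pal0 SW; have h2 := mulr_ge0 (ltW ga0) SA.
lra.
Qed.

End Sparse.

(** * Asymptotics *)

(** Double counting: the degrees of the members of [l] are summed over all [v] outside [l]. Omitting
    the pairs inside [l] costs each member at most [m * Q], so the average over [v] still exceeds
    the [lam] bound. *)
Lemma avg_large_deg (R : realType) (V : finType) (w : V -> V -> nat) (lam e Q : R) m :
  0 <= lam -> 0 <= Q -> (forall u v, u != v -> ln (w u v)%:R <= Q) ->
  (forall u, (lam + e) * (#|V|%:R - 1) < \sum_(v | v != u) ln (w u v)%:R) ->
  m%:R * Q <= e * (#|V|%:R - 1) ->
  forall (l : seq V) (y : V -> R), (0 < size l <= m)%N ->
  {in l, forall u, 0 < y u} -> exists2 v, v \notin l &
    lam * (\sum_(u <- l) y u) < \sum_(u <- l) y u * ln (w u v)%:R.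
Proof.
move=> lam0 Q0 wQ big mQ l y /andP[l0 lm] y0; apply: contrapT => no.
have small v : v \notin l ->
    \sum_(u <- l) y u * ln (w u v)%:R <= lam * (\sum_(u <- l) y u).
  by move=> vl; rewrite leNgt; apply/negP => lt; apply: no; exists v.
set Y := \sum_(u <- l) y u in small.
have Y0 : 0 < Y.
  rewrite /Y; case: (l) l0 y0 => // u t _ yt; rewrite big_cons ltr_pwDl ?yt ?mem_head //.
  by rewrite big_seq sumr_ge0 // => x xt; rewrite ltW // yt // inE xt orbT.
have up : \sum_(v | v \notin l) \sum_(u <- l) y u * ln (w u v)%:R <= lam * Y * (#|V|%:R - 1).
  apply: le_trans (ler_sum _ (fun v (vl : v \notin l) => small v vl)) _.
  rewrite sumr_const -[_ *+ _]mulr_natr ler_wpM2l ?mulr_ge0 ?(ltW Y0) //.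
  rewrite lerBrDr natr1 ler_nat.
  case: (l) l0 => // u t _; apply: proper_card.
  apply/fintype.properP; split; first exact/fintype.subsetP.
  by exists u => //; rewrite unfold_in /= negbK mem_head.
have low : Y * ((lam + e) * (#|V|%:R - 1) - m%:R * Q) <
    \sum_(v | v \notin l) \sum_(u <- l) y u * ln (w u v)%:R.
  rewrite exchange_big /= /Y mulr_suml.
  have st u : u \in l -> y u * ((lam + e) * (#|V|%:R - 1) - m%:R * Q) <
      \sum_(v | v \notin l) y u * ln (w u v)%:R.
    move=> ul; rewrite -mulr_sumr ltr_pM2l ?y0 // ltrBlDr.
    apply: lt_le_trans (big u) _.
    rewrite (bigID (fun v => v \in l)) /= addrC lerD //.
      rewrite (eq_bigl (fun v => v \notin l)) // => v /=.
      by case: (eqVneq v u) => // ->; rewrite ul.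
    apply: le_trans (_ : \sum_(v | (v != u) && (v \in l)) Q <= _).
      by apply: ler_sum => v /andP[vu _]; rewrite wQ // eq_sym.
    rewrite sumr_const -[_ *+ _]mulr_natl ler_wpM2r // ler_nat.
    apply: leq_trans lm; apply: leq_trans (card_size l).
    by apply/subset_leq_card/fintype.subsetP => v; rewrite unfold_in => /andP[].
  case: (l) l0 st => // u t _ st; rewrite !big_cons ltr_leD ?st ?mem_head //.
  rewrite big_seq [leRHS]big_seq ler_sum // => x xt.
  by rewrite ltW // st // inE xt orbT.
have := lt_le_trans low up; rewrite [lam * Y]mulrC -mulrA ltr_pM2l //.
lra.
Qed.

Lemma superset_card (V : finType) (A : {set V}) k : (#|A| <= k <= #|V|)%N ->
  exists2 X : {set V}, A \subset X & #|X| = k.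
Proof.
move=> /andP[Ak kV]; have [n] := ubnP (k - #|A|); elim: n A Ak => // n IH A Ak An.
have [kA|ne] := eqVneq #|A| k; first by exists A.
have lt : (#|A| < k)%N by rewrite ltn_neqAle ne.
have /card_gt0P[x] : (0 < #|~: A|)%N by have := cardsC A; lia.
rewrite !inE => xA; have cx : #|x |: A| = #|A|.+1 by rewrite cardsU1 xA.
have [||X sub kX] := IH (x |: A); rewrite ?cx //; first by lia.
by exists X => //; apply: fintype.subset_trans sub; apply: finset.subsetUr.
Qed.

(** * Logarithms of edge products and crude bounds *)

Section LogProduct.
Variables (R : realType) (V : finType).
Implicit Types (G : multigraph V) (S : {set V}).

Definition lsum G S : R :=
  \sum_(e : {set V} | (e \subset S) && (#|e| == 2%N)) ln (G e)%:R.

Definition positive_in G S := forall e : {set V}, e \subset S -> #|e| = 2%N -> (0 < G e)%N.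

Lemma ln_edge_prod G S : positive_in G S -> ln (edge_prod_in G S)%:R = lsum G S.
Proof.
move=> G0; suff [] : (0 < edge_prod_in G S)%N /\ ln (edge_prod_in G S)%:R = lsum G S by [].
apply: (big_ind2 (fun (x : nat) (y : R) => (0 < x)%N /\ ln x%:R = y)).
- by rewrite ln1.
- move=> x1 y1 x2 y2 [x0 <-] [x20 <-]; rewrite muln_gt0 x0 x20 natrM lnM ?posrE ?ltr0n //.
- by move=> e /andP[eS /eqP e2]; rewrite G0.
Qed.

Lemma lsumU1 G S v : v \notin S ->
  lsum G (v |: S) = \sum_(u in S) ln (G [set u; v])%:R + lsum G S.
Proof. exact: big_pairsU1. Qed.

Lemma lsum0 G : lsum G finset.set0 = 0.
Proof. exact: big_pairs0. Qed.

End LogProduct.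

Section Bounds.
Variables (V : finType) (G : multigraph V) (s q : nat).
Hypotheses (s2 : (1 < s)%N) (sV : (s <= #|V|)%N) (Gsq : sq_graph s q G).

Lemma sq_graph_le (e : {set V}) : #|e| = 2%N -> (G e <= q)%N.
Proof.
move=> e2; have [|X eX sX] := @superset_card V e s; first by rewrite e2 s2.
apply: leq_trans (Gsq sX); rewrite /edge_sum_in (bigD1 e) /= ?leq_addr //.
by rewrite eX e2.
Qed.

Lemma sq_graph_prod_le : (edge_prod G <= q ^ #|[set e : {set V} | #|e| == 2]|)%N.
Proof.
rewrite /edge_prod /edge_prod_in -prod_nat_const big_mkcond [leqRHS]big_mkcond /=.
apply: leq_prod => e _; rewrite inE finset.subsetT /=.
by case: eqP => // /sq_graph_le.
Qed.

End Bounds.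

Lemma max_setP (A : classical_sets.set nat) m : (exists k, A k) ->
  (forall k, A k -> (k <= m)%N) ->
  A (max_set A) /\ forall k, A k -> (k <= max_set A)%N.
Proof.
move=> [k0 Ak0] Am; rewrite /max_set.
have [x [Ax xm]] : exists x, A x /\ forall k, A k -> (k <= x)%N.
  have ex : exists k, `[< A k >] by exists k0; apply/asboolP.
  have bd k : `[< A k >] -> (k <= m)%N by move/asboolP/Am.
  case: (ex_maxnP ex bd) => x /asboolP Ax xm; exists x; split=> // k Ak.
  by apply: xm; apply/asboolP.
by apply: (xgetPex 0%N (P := fun m => A m /\ forall k, A k -> (k <= m)%N)); exists x.
Qed.

(** * The lower bound for blow-ups of the Turan pattern *)

Section TuranLower.
Variables (R : realType) (r0 rd d a : nat).
Hypotheses (r0_gt0 : (0 < r0)%N) (rd_gt0 : (0 < rd)%N) (d_gt0 : (0 < d)%N).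
Hypothesis da : (d < a)%N.
Notation r := (r0 :: rcons (nseq d.-1 0%N) rd).
Notation T := (turan_pattern r a).
Notation top := (@top_block r0 rd d).
Notation ga := (top_weight R rd d a).
Notation al := (low_weight R a).
Notation lam := (rate R r0 rd d a).

Let y i : R := if top i then ga else al.

Let turanE i j : (T [set i; j] + defect d top i j)%N = a.+1.
Proof. by apply: turan_two_blocks => //; apply: ltnW. Qed.

Lemma turan_gt0 i j : (0 < T [set i; j])%N.
Proof.
have := turanE i j; rewrite /defect.
case: (i == j); case: (top i); case: (top j) => /=; lia.
Qed.

Lemma ln_turan i j : ln (T [set i; j])%:R = ln a.+1%:R - ell R a (defect d top i j).
Proof.
rewrite /ell -(turanE i j) addnK; lra.
Qed.

Lemma sum_weight : \sum_i y i = r0%:R * ga + rd%:R * al.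
Proof.
rewrite (bigID top) /= (eq_bigr (fun=> ga)) => [|i ti]; last by rewrite /y ti.
rewrite [X in _ + X](eq_bigr (fun=> al)) => [|i /negPf ti]; last by rewrite /y ti.
rewrite !sumr_const (eq_card (B := top)) // card_top_block.
by rewrite [X in _ + _ *+ X](eq_card (B := predC top)) // card_low_block !mulr_natl.
Qed.

(* With these weights every vertex of the pattern has the same logarithmic degree. *)
Lemma sum_weight_ell j : \sum_i y i * ell R a (defect d top j i) = al * ga.
Proof.
have djj : defect d top j j = (1 + d * ~~ top j)%N by rewrite /defect eqxx andbb.
rewrite (bigD1 j) //= djj.
have off i : i != j -> defect d top j i = (d * (~~ top j && ~~ top i))%N.
  by rewrite /defect eq_sym => /negPf ->.
case: (boolP (top j)) => tj.
  rewrite big1 => [|i ij]; last by rewrite off // tj muln0 ell0 mulr0.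
  by rewrite /y tj muln0 addn0 addr0 mulrC.
rewrite (eq_bigr (fun i => if ~~ top i then al * ell R a d else 0)); last first.
  move=> i ij; rewrite off // tj /y /=; case: (top i) => /=; last by rewrite muln1.
  by rewrite muln0 ell0 mulr0.
rewrite -big_mkcondr sumr_const (eq_card (B := [predD1 (predC top) & j])); last first.
  by move=> i; rewrite !inE.
have := cardD1 j (predC top); rewrite card_low_block inE /= tj.
move=> /(congr1 predn); rewrite /= add0n => <-.
rewrite /y (negPf tj) /= muln1 add1n /top_weight -(mulr_natl (al * _)); lra.
Qed.

(** The average over the types [i], weighted by [y], of the logarithmic degree into [S] is exactly
    [lam * #|S|], so some type attains it. *)
Lemma turan_extend (V : finType) (S : {set V}) (f : V -> 'I_(sumn r)) :
  exists i, lam * #|S|%:R <= \sum_(u in S) ln (T [set f u; i])%:R.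
Proof.
apply: contrapT => no.
have R0 : (0 < sumn r)%N by rewrite sumn_two_blocks addn_gt0 r0_gt0.
pose x i := \sum_(u in S) ln (T [set f u; i])%:R : R.
have lt i : x i < lam * #|S|%:R.
  by rewrite ltNge; apply/negP => le; apply: no; exists i.
have y0 i : 0 < y i.
  by rewrite /y; case: ifP => _; [apply: top_weight_gt0 | apply: low_weight_gt0 da].
have z : \sum_i y i * (lam * #|S|%:R - x i) = 0.
  under eq_bigr do rewrite mulrBr.
  rewrite sumrB -mulr_suml.
  have -> : \sum_i y i * x i = \sum_(u in S) (ln a.+1%:R * (\sum_i y i) - al * ga).
    under eq_bigr do rewrite /x mulr_sumr.
    rewrite exchange_big /=; apply: eq_bigr => u _.
    rewrite -(sum_weight_ell (f u)) mulr_sumr -sumrB; apply: eq_bigr => i _.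
    by rewrite ln_turan; lra.
  rewrite sumr_const -[_ *+ _]mulr_natr sum_weight -(lossE R r0_gt0 rd_gt0 da) /rate.
  by ring.
have nn i : 0 <= y i * (lam * #|S|%:R - x i).
  by apply: mulr_ge0; [exact: ltW | rewrite subr_ge0; exact: ltW].
have /(_ (Ordinal R0) isT)/eqP := psumr_eq0P (fun i _ => nn i) z.
by rewrite mulf_eq0 !gt_eqF ?subr_gt0.
Qed.

Lemma turan_lsum (V : finType) (S : {set V}) : exists f : V -> 'I_(sumn r),
  lam * 'C(#|S|, 2)%:R <= lsum R (fun e => T (f @: e)) S.
Proof.
have R0 : (0 < sumn r)%N by rewrite sumn_two_blocks addn_gt0 r0_gt0.
have [n] := ubnP #|S|; elim: n S => // n IH S Sn.
have [->|[v vS]] := set_0Vmem S.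
  by exists (fun=> Ordinal R0); rewrite cards0 mulr0 lsum0.
have SE := finset.setD1K vS; have vS' : v \notin S :\ v by rewrite !inE eqxx.
have cS : #|S| = #|S :\ v|.+1 by rewrite (cardsD1 v S) vS.
have [|f fS] := IH (S :\ v); first by move: Sn; rewrite cS.
have [i iS] := turan_extend (S :\ v) f.
pose g u := if u == v then i else f u.
exists g; have -> : lsum R (fun e => T (g @: e)) S =
    \sum_(u in S :\ v) ln (T (g @: [set u; v]))%:R +
    lsum R (fun e => T (g @: e)) (S :\ v) by rewrite -{1}SE lsumU1.
rewrite cS binS bin1 natrD mulrDr [leLHS]addrC lerD //.
  apply: le_trans iS _; apply: ler_sum => u uS.
  rewrite imsetU !imset_set1 /g eqxx; case: eqP => // uv.
  by rewrite uv (negPf vS') in uS.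
apply: le_trans fS _; rewrite /lsum le_eqVlt; apply/orP; left; apply/eqP.
apply: eq_bigr => e /andP[eS _]; congr (ln (T _)%:R).
apply: eq_in_imset => u ue; rewrite /g; case: eqP => // uv.
by have := fintype.subsetP eS u ue; rewrite uv (negPf vS').
Qed.

Lemma ln_Pi_turan n : lam * 'C(n, 2)%:R <= ln (Pi_pat T n)%:R.
Proof.
have [f fP] := turan_lsum [set: 'I_n].
pose F := [ffun x => f x].
have FE (e : {set 'I_n}) : blowup T F e = T (f @: e).
  by congr (T _); apply: eq_imset => x; rewrite ffunE.
have pos : positive_in (blowup T F) [set: 'I_n].
  move=> e _ /eqP/cards2P[x [y' [_ ->]]]; rewrite blowupE; exact: turan_gt0.
have E : ln (edge_prod (blowup T F))%:R = lsum R (fun e => T (f @: e)) [set: 'I_n].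
  by rewrite [LHS](ln_edge_prod R pos); apply: eq_bigr => e _; rewrite FE.
have P0 : (0 < edge_prod (blowup T F))%N.
  by apply: prodn_cond_gt0 => e /andP[eS /eqP]; apply: pos.
have le : (edge_prod (blowup T F) <= Pi_pat T n)%N.
  exact: (leq_bigmax_cond (F := fun F => edge_prod (blowup T F))).
move: fP; rewrite cardsT card_ord -E => /le_trans; apply.
by rewrite ler_ln ?posrE ?ltr0n ?ler_nat // (leq_trans P0).
Qed.

End TuranLower.

Lemma psum_map (V W : eqType) (g : W -> V) (c : V -> V -> nat) (l : seq W) :
  psum c (map g l) = psum (fun u v => c (g u) (g v)) l.
Proof. by elim: l => //= x l ->; rewrite /deg big_map. Qed.

(** * The upper bound by deletion of vertices *)

Section Upper.
Variables (R : realType) (r0 rd d s a m : nat).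
Hypotheses (r0_gt0 : (0 < r0)%N) (rd_gt0 : (0 < rd)%N) (d_gt0 : (0 < d)%N).
Variables (p N : nat).
Hypotheses (pE : p = (d * rd).+1) (NE : N = (r0 * p + rd)%N).
Hypothesis sN : (N < s)%N.
Notation M := (r0 * p.+1)%N.
Notation B := ((p * (p * N)).+1 * (N * ((M * (N * N) + M) * N).+1) + p * N)%N.
Hypotheses (sm : (s <= m)%N) (Bm : (B <= m)%N) (Mm : (M + rd <= m)%N).
Hypotheses (am : (p * d.+1 * m <= a - d)%N) (da : (d < a)%N)
  (ap : (p + d * p.+1 <= a)%N).
Notation r := (r0 :: rcons (nseq d.-1 0%N) rd).
Notation T := (turan_pattern r a).
Notation lam := (rate R r0 rd d a).
Notation q := (Sigma_pat T s).

Let s_gt1 : (1 < s)%N.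
Proof. by apply: leq_ltn_trans sN; rewrite NE addn_gt0 rd_gt0 orbT. Qed.

Let a_gt1 : (1 < a)%N. Proof. exact: leq_ltn_trans d_gt0 da. Qed.

Section Fixed.
Variables (V : finType) (G : multigraph V).
Hypotheses (sV : (s <= #|V|)%N) (Gsq : sq_graph s q G).
Hypothesis Gpos : forall e : {set V}, #|e| = 2%N -> (0 < G e)%N.

Let q1 : (0 < q)%N.
Proof.
have [|X _ sX] := @superset_card V finset.set0 s; first by rewrite cards0.
have : (1 < #|X|)%N by rewrite sX.
case/card_gt1P => u [v [_ _ uv]].
have e2 : #|[set u; v]| = 2%N by rewrite cards2 uv.
exact: leq_trans (Gpos e2) (sq_graph_le s_gt1 sV Gsq e2).
Qed.

Let Q0 : 0 <= ln q%:R :> R.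
Proof. by rewrite ln_ge0 // ler1n. Qed.

Let lnG_le (e : {set V}) : #|e| = 2%N -> ln (G e)%:R <= ln q%:R :> R.
Proof.
move=> e2; rewrite ler_ln ?posrE ?ltr0n ?Gpos // ler_nat.
exact: (sq_graph_le s_gt1 sV Gsq e2).
Qed.

(** Otherwise the multigraph induced on [S], viewed on the subtype [W], satisfies [avg_large_deg],
    which [no_large_deg] refutes. *)
Lemma small_log_degree (e : R) (S : {set V}) : 0 < e -> (0 < #|S|)%N ->
  m%:R * ln q%:R <= e * (#|S|%:R - 1) ->
  exists2 u, u \in S &
    \sum_(v in S :\ u) ln (G [set v; u])%:R <= (lam + e) * (#|S|%:R - 1).
Proof.
move=> e0 S0 mQ; apply: contrapT => no.
have /card_gt0P[x xS] := S0.
pose W := {x : V | x \in S}.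
pose w (u v : W) := G [set val u; val v].
have cW : #|{: W}| = #|S| by rewrite card_sig; apply: eq_card.
have neq2 (u v : W) : u != v -> #|[set val u; val v]| = 2%N.
  by move=> uv; rewrite cards2 (inj_eq val_inj) uv.
apply: (@no_large_deg R r0 rd d s a r0_gt0 rd_gt0 d_gt0 p N m pE NE sN sm Bm Mm am da ap
  W w (Sub x xS)).
- by move=> u v; rewrite /w finset.setUC.
- by move=> u v /neq2; apply: Gpos.
- move=> l ul sl; have := Sigma_turan r0_gt0 rd_gt0 d_gt0 (ltnW da) s; rewrite -pE -NE.
  apply: leq_trans; rewrite leq_add2r /w.
  rewrite -(psum_map val (fun u v => G [set u; v])) -edge_sum_in_seq; last first.
    by rewrite (map_inj_uniq val_inj).
  apply: Gsq; rewrite -sl -(size_map val) -(card_uniqP (_ : uniq (map val l))).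
    by apply: eq_card => y; rewrite inE.
  by rewrite (map_inj_uniq val_inj).
apply: (@avg_large_deg R W w lam e (ln q%:R) m).
- exact/ltW/rate_gt0.
- exact: Q0.
- by move=> u v /neq2; apply: lnG_le.
- move=> u; rewrite cW ltNge; apply/negP => le; apply: no; exists (val u); first exact: valP.
  apply: le_trans le; rewrite le_eqVlt; apply/orP; left; apply/eqP.
  transitivity (\sum_(v in S | v != val u) ln (G [set v; val u])%:R : R).
    by apply: eq_bigl => v; rewrite !inE andbC.
  rewrite (big_sub_cond (mem S) (fun v => v != val u)); apply: eq_big => v //=.
  by rewrite /w finset.setUC.
- by rewrite cW.
Qed.

(** Vertices of small logarithmic degree are deleted until at most [k.+1] remain; each surviving
    pair is then bounded by [ln q]. *)
Lemma lsum_le (e : R) (k : nat) (S : {set V}) : 0 < e ->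
  m%:R * ln q%:R <= e * k%:R ->
  lsum R G S <= (lam + e) * 'C(#|S|, 2)%:R + ln q%:R * 'C(k.+1, 2)%:R.
Proof.
move=> e0 mQ; have [n] := ubnP #|S|; elim: n S => // n IH S Sn.
have lam0 := rate_gt0 R r0_gt0 rd_gt0 da a_gt1.
have [Sk|kS] := leqP #|S| k.+1.
  have L : lsum R G S <= ln q%:R * 'C(#|S|, 2)%:R.
    rewrite -cards_draws mulr_natr -sumr_const.
    rewrite (eq_bigl (fun f : {set V} => (f \subset S) && (#|f| == 2%N))) => [|f].
      by apply: ler_sum => f /andP[_ /eqP]; apply: lnG_le.
    by rewrite inE.
  apply: le_trans L _; apply: ler_wpDl; first by rewrite mulr_ge0 // addr_ge0 ?ltW.
  by rewrite ler_wpM2l // ler_nat leq_bin2l.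
have [||u uS du] := @small_log_degree e S e0.
- exact: leq_ltn_trans kS.
- apply: le_trans mQ _; rewrite ler_wpM2l ?(ltW e0) //.
  by rewrite lerBrDr natr1 ler_nat ltnW.
have SE := finset.setD1K uS; have uS' : u \notin S :\ u by rewrite !inE eqxx.
have cS : #|S| = #|S :\ u|.+1 by rewrite (cardsD1 u S) uS.
have := IH (S :\ u); rewrite -ltnS -cS => /(_ Sn) {}IH.
have -> : lsum R G S = \sum_(v in S :\ u) ln (G [set v; u])%:R + lsum R G (S :\ u).
  by rewrite -{1}SE lsumU1.
have -> : 'C(#|S|, 2)%:R = 'C(#|S :\ u|, 2)%:R + (#|S|%:R - 1) :> R.
  by rewrite cS binS bin1 natrD -natr1; lra.
lra.
Qed.

End Fixed.

Lemma ln_sq_graph_le (e : R) (k n : nat) (G : multigraph 'I_n) : (s <= n)%N ->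
  sq_graph s q G -> (0 < edge_prod G)%N -> 0 < e -> m%:R * ln q%:R <= e * k%:R ->
  ln (edge_prod G)%:R <= (lam + e) * 'C(n, 2)%:R + ln q%:R * 'C(k.+1, 2)%:R.
Proof.
move=> sn Gsq G0 e0 mQ.
have Gpos (f : {set 'I_n}) : #|f| = 2%N -> (0 < G f)%N.
  move=> f2; move: G0; rewrite /edge_prod /edge_prod_in (bigD1 f) /=.
    by rewrite muln_gt0 => /andP[].
  by rewrite finset.subsetT f2.
rewrite [X in X <= _]ln_edge_prod => [|f _]; last exact: Gpos.
have := @lsum_le 'I_n G _ Gsq Gpos e k [set: 'I_n] e0 mQ.
by rewrite cardsT card_ord; apply.
Qed.

End Upper.

(** An [s]-subset of a blow-up, enumerated by ['I_s], is itself a blow-up on [s] vertices. *)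
Lemma blowup_sq (V : finType) (P : pattern V) n s (f : {ffun 'I_n -> V}) :
  sq_graph s (Sigma_pat P s) (blowup P f).
Proof.
move=> X sX; pose g (i : 'I_s) := enum_val (cast_ord (esym sX) i).
have g_inj : injective g by move=> i j /enum_val_inj/cast_ord_inj.
have ug : uniq (map g (enum [set: 'I_s])) by rewrite map_inj_uniq ?enum_uniq.
have XE : X = [set x in map g (enum [set: 'I_s])].
  apply/eqP; rewrite eq_sym eqEcard; apply/andP; split.
    apply/fintype.subsetP => x; rewrite inE => /mapP[i _ ->]; exact: enum_valP.
  by rewrite sX cardsE (card_uniqP ug) size_map -cardE cardsT card_ord.
rewrite [X in edge_sum_in _ X]XE edge_sum_in_seq // psum_map.
apply: leq_trans (leq_bigmax_cond (F := fun F => edge_sum (blowup P F)) [ffun i => f (g i)] _) => //.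
rewrite /edge_sum edge_sum_in_enum.
have -> : psum (fun u v => blowup P [ffun i => f (g i)] [set u; v]) =
    psum (fun u v => blowup P f [set g u; g v]); last by [].
by congr psum; apply/funext => u; apply/funext => v; rewrite !blowupE !ffunE.
Qed.

Lemma ex_PiP (V : finType) (P : pattern V) n s : (1 < s <= n)%N ->
  (exists G : multigraph 'I_n, sq_graph s (Sigma_pat P s) G /\
     edge_prod G = ex_Pi n s (Sigma_pat P s)) /\
  (forall f : {ffun 'I_n -> V}, edge_prod (blowup P f) <= ex_Pi n s (Sigma_pat P s))%N.
Proof.
move=> /andP[s1 sn]; set A := fun m => exists G : multigraph 'I_n,
  sq_graph s (Sigma_pat P s) G /\ edge_prod G = m.
have [||ex_in ex_max] := @max_setP A
    (Sigma_pat P s ^ #|[set e : {set 'I_n} | #|e| == 2%N]|)%N.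
- exists (edge_prod (fun _ : {set 'I_n} => 0%N)), (fun=> 0%N); split=> // X _.
  by rewrite /edge_sum_in big1.
- by move=> k [G [Gsq <-]]; apply: (sq_graph_prod_le s1 _ Gsq); rewrite card_ord.
by split=> // f; apply: ex_max; exists (blowup P f); split=> //; apply: blowup_sq.
Qed.

Import numFieldNormedType.Exports.
Local Open Scope classical_set_scope.
Local Open Scope ring_scope.

Theorem theorem1p15 (R : realType) (r0 rd d s : nat)
    (r0_gt0 : (0 < r0)%N) (rd_gt0 : (0 < rd)%N) (d_gt0 : (0 < d)%N)
    (s_ge : (r0 * (d * rd + 1) + rd + 1 <= s)%N) :
  let r : seq nat := r0 :: rcons (nseq d.-1 0%N) rd in
  exists a0 : nat, forall a : nat, (a0 <= a)%N ->
  let T := turan_pattern r a in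
  exists eps : nat -> R,
    eps n @[n --> \oo] --> (0 : R) /\
    forall n : nat, (s <= n)%N ->
      (ex_Pi n s (Sigma_pat T s))%:R = (Pi_pat T n)%:R `^ (1 + eps n).
Proof.
move=> r; pose p := (d * rd).+1; pose N := (r0 * p + rd)%N; pose M := (r0 * p.+1)%N.
have sN : (N < s)%N by move: s_ge; rewrite !addn1.
pose B := ((p * (p * N)).+1 * (N * ((M * (N * N) + M) * N).+1) + p * N)%N.
(* [m] bounds the length of every list to which the degree assumption is applied; only then is [a]
   chosen large in terms of [m]. *)
pose m := (s + B + (M + rd))%N.
exists (d + p * d.+1 * m + (p + d * p.+1)).+1 => a a0 T.
have sm : (s <= m)%N by rewrite /m -addnA leq_addr.
have Bm : (B <= m)%N by rewrite /m -addnA addnCA leq_addr.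
have Mm : (M + rd <= m)%N by rewrite leq_addl.
have am : (p * d.+1 * m <= a - d)%N by move: a0; clear; lia.
have da : (d < a)%N by move: a0; clear; lia.
have ap : (p + d * p.+1 <= a)%N by move: a0; clear; lia.
have s1 : (1 < s)%N by apply: leq_ltn_trans sN; rewrite addn_gt0 rd_gt0 orbT.
have a1 : (1 < a)%N by apply: leq_ltn_trans da.
set lam := rate R r0 rd d a; set Q := ln (Sigma_pat T s)%:R : R.
have lam0 : 0 < lam by apply: rate_gt0.
have up := @ln_sq_graph_le R r0 rd d s a m r0_gt0 rd_gt0 d_gt0 p N erefl erefl sN
  sm Bm Mm am da ap.
have low n := ln_Pi_turan R r0_gt0 rd_gt0 d_gt0 da n.
have C0 n : (s <= n)%N -> (n.-1 <= 'C(n, 2))%N.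
  by case: n => // n _; rewrite binS bin1 leq_addl.
have Pi1 n : (s <= n)%N -> 0 < ln (Pi_pat T n)%:R :> R.
  move=> sn; apply: lt_le_trans (low n); rewrite mulr_gt0 // ltr0n.
  by apply: leq_trans (C0 n sn); move: s1 sn; clear; lia.
have Pi0 n : (s <= n)%N -> (0 < Pi_pat T n)%N.
  (* The default value [ln 0 = 0] contradicts the positive logarithm. *)
  move=> sn; have := Pi1 n sn; case: (Pi_pat T n) => //; rewrite ln0 ?ltxx //.
have Pi_ex n : (s <= n)%N -> (Pi_pat T n <= ex_Pi n s (Sigma_pat T s))%N.
  move=> sn; have [|_ H] := @ex_PiP _ T n s; first by rewrite s1.
  by apply/bigmax_leqP => f _; apply: H.
have ex0 n : (s <= n)%N -> (0 < ex_Pi n s (Sigma_pat T s))%N.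
  by move=> sn; apply: leq_trans (Pi_ex n sn); apply: Pi0.
(* With this exponent the equation is exact, and only the limit needs the bounds. *)
pose eps n : R := ln (ex_Pi n s (Sigma_pat T s))%:R / ln (Pi_pat T n)%:R - 1.
exists eps; split; last first.
  move=> n sn; rewrite /powR pnatr_eq0 gtn_eqF ?Pi0 // /eps addrC subrK divfK.
    by rewrite lnK // posrE ltr0n ex0.
  by rewrite gt_eqF // Pi1.
have eps0 n : (s <= n)%N -> 0 <= eps n.
  move=> sn; rewrite subr_ge0 ler_pdivlMr ?Pi1 // mul1r.
  by rewrite ler_ln ?posrE ?ltr0n ?ler_nat ?Pi0 ?ex0 ?Pi_ex.
(* Half of [lam * e] pays for the excess degree, the other half for the constant [C] once ['C(n, 2)]
   is large. *)
apply/cvgrPdist_le => e e0; pose e' := lam * (e / 2).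
have e'0 : 0 < e' by rewrite mulr_gt0 // divr_gt0.
pose k := (Num.trunc (m%:R * Q / e')).+1.
have mQ : m%:R * Q <= e' * k%:R.
  by rewrite [leRHS]mulrC -ler_pdivrMr // ltW // truncnS_gt.
pose C := Q * 'C(k.+1, 2)%:R.
pose n1 := (Num.trunc (C / e')).+1.
near=> n.
have sn : (s <= n)%N by near: n; apply: nbhs_infty_ge.
have n1n : (n1 < n)%N by near: n; apply: nbhs_infty_ge.
rewrite sub0r normrN ger0_norm ?eps0 // /eps lerBlDr ler_pdivrMr ?Pi1 //.
have [|[G [Gsq GE]] _] := @ex_PiP _ T n s; first by rewrite s1.
have := up e' k n G sn Gsq; rewrite GE => /(_ (ex0 n sn) e'0 mQ) H.
apply: le_trans H _; apply: le_trans (ler_wpM2l _ (low n)); last by rewrite addr_ge0 // ltW.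
have Cn : C <= e' * 'C(n, 2)%:R.
  rewrite [leRHS]mulrC -ler_pdivrMr //; apply: le_trans (ltW (truncnS_gt _)) _.
  by rewrite ler_nat; apply: leq_trans (C0 n sn); rewrite -ltnS prednK // (leq_trans _ n1n).
rewrite -/lam -/Q -/C; move: Cn; rewrite /e'; lra.
Unshelve. all: by end_near.
Qed.
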